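(* Let $X, Y\subseteq\mathbb{C}$ be perfect compact sets and $(M_n)$ a weight sequence such that $D(X,M)$ and $D(Y,M)$ are good. Let $\phi\in D(X,M)$. If $\phi(X)\subseteq \operatorname{int}(Y)$, then $\phi$ induces a compact homomorphism $D(Y,M)\to D(X,M)$.
   Context: For a perfect compact plane set $X$, $f:X\to\mathbb{C}$ is complex-differentiable at $a\in X$ if $f'(a)=\lim_{z\to a,\ z\in X}\frac{f(z)-f(a)}{z-a}$ exists; $f^{(n)}$ denotes the $n$-th complex derivative in this sense (with $f^{(0)}=f$), and $D^\infty(X)$ is the set of infinitely complex-differentiable functions on $X$. A weight sequence is a sequence $(M_n)_{n\ge 0}$ of positive numbers with $M_0=1$ and $\frac{M_{n+m}}{M_nM_m}\ge\binom{n+m}{n}$ for all non-negative integers $m,n$. The Dales-Davie algebra is $$D(X,M)=\Big\{f\in D^\infty(X):\ \|f\|_D=\sum_{n=0}^\infty\frac{\|f^{(n)}\|_\infty}{M_n}<\infty\Big\},$$ where $\|\cdot\|_\infty$ is the supremum norm on $X$. A set $X$ is good if $D(X,M)$ is complete for all weight sequences $(M_n)$. The sequence $(M_n)$ is non-analytic if $\lim_{n\to\infty}(n!/M_n)^{1/n}=0$. $D(X,M)$ is natural if its maximal ideal space is precisely $X$ (every character is evaluation at a point of $X$). The algebra $D(X,M)$ is good if $X$ is good, $(M_n)$ is non-analytic and $D(X,M)$ is natural. A map $\phi:X\to Y$ induces a homomorphism $D(Y,M)\to D(X,M)$ if $f\circ\phi\in D(X,M)$ for every $f\in D(Y,M)$;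 the induced homomorphism is $f\mapsto f\circ\phi$, and it is called compact if it is a compact linear operator. $\operatorname{int}(Y)$ is the interior of $Y$ in $\mathbb{C}$. *)

(* Defs.v *)
From HB Require Import structures.
From mathcomp Require Import all_boot all_order all_algebra.
From mathcomp Require Import complex.
From mathcomp Require Import all_classical all_reals all_analysis.

Set Implicit Arguments.
Unset Strict Implicit.
Unset Printing Implicit Defensive.

Import Order.TTheory GRing.Theory Num.Theory.
Import numFieldNormedType.Exports.

Local Open Scope classical_set_scope.
Local Open Scope ring_scope.
Local Open Scope complex_scope.

(* MathComp-Analysis topologizes an abstract numFieldType K through K^o; the
   same metric topology is registered here on the concrete type R[i]. *)
HB.instance Definition _ (R : rcfType) := PseudoPointedMetric.copy R[i] R[i]^o.
HB.instance Definition _ (R : rcfType) := NormedModule.copy R[i] R[i]^o.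

Section DalesDavie.
Context {R : realType}.
Implicit Types (X Y : set R[i]) (M : nat -> R) (f g phi : R[i] -> R[i]).
Implicit Types (u : nat -> R[i] -> R[i]).

(* A function on X is represented by a total function on R[i]; only its values
   on X are relevant. Accordingly, maps defined on D(X,M) are required to
   respect equality on X. *)
Definition eq_on X f g := forall z, X z -> f z = g z.

Definition complex_differentiable X f (a : R[i]) :=
  cvg ((f z - f a) / (z - a) @[z --> within X a^']).

Definition cderiv X f (a : R[i]) : R[i] :=
  lim ((f z - f a) / (z - a) @[z --> within X a^']).

Definition cderivn X (n : nat) f : R[i] -> R[i] := iter n (cderiv X) f.

Definition infinitely_differentiable X f :=
  forall n a, X a -> complex_differentiable X (cderivn X n f) a.

(* [sup] takes the value 0 on sets without a supremum: this gives norm 0 when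
   X is empty, and it is otherwise only used for functions that are continuous
   on a compact set X. *)
Definition supnorm X f : R := sup [set Normc.normc (f z) | z in X].

Definition weight_sequence M :=
  [/\ forall n, 0 < M n,
      M 0%N = 1 &
      forall m n, ('C(n + m, n))%:R <= M (n + m)%N / (M n * M m)].

Definition non_analytic M :=
  (n`!%:R / M n) `^ (n%:R^-1) @[n --> \oo] --> (0 : R).

Definition dnorm X M f : \bar R :=
  (\sum_(0 <= n <oo) (supnorm X (cderivn X n f) / M n)%:E)%E.

Definition Dalg X M : set (R[i] -> R[i]) :=
  [set f | infinitely_differentiable X f /\ (dnorm X M f < +oo)%E].

Definition Dcauchy X M u := forall e : R, 0 < e ->
  exists N : nat, forall m n, (N <= m)%N -> (N <= n)%N ->
    (dnorm X M (u m - u n)%R < e%:E)%E.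

Definition Dcvg_to X M u g := dnorm X M (u k - g) @[k --> \oo] --> 0%E.

Definition Dcomplete X M := forall u,
  (forall k, Dalg X M (u k)) -> Dcauchy X M u ->
  exists2 g, Dalg X M g & Dcvg_to X M u g.

Definition good_set X := forall M, weight_sequence M -> Dcomplete X M.

Record character X M (chi : (R[i] -> R[i]) -> R[i]) : Prop := Character {
  character_ext : forall f g, Dalg X M f -> Dalg X M g ->
    eq_on X f g -> chi f = chi g ;
  character_linear : forall (a : R[i]) f g, Dalg X M f -> Dalg X M g ->
    chi (a *: f + g) = a * chi f + chi g ;
  character_mul : forall f g, Dalg X M f -> Dalg X M g ->
    chi (f * g) = chi f * chi g ;
  character_neq0 : exists2 f, Dalg X M f & chi f <> 0 }.

Definition natural X M := forall chi, character X M chi ->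
  exists2 a, X a & forall f, Dalg X M f -> chi f = f a.

Definition good_algebra X M := [/\ good_set X, non_analytic M & natural X M].

Definition induces_homomorphism X Y M phi :=
  phi @` X `<=` Y /\ forall f, Dalg Y M f -> Dalg X M (f \o phi).

(* The last field says that T is a compact operator: it sends bounded sequences
   to sequences having a convergent subsequence. *)
Record compact_linear_operator Y X M
    (T : (R[i] -> R[i]) -> (R[i] -> R[i])) : Prop := CompactLinearOperator {
  clo_maps : forall f, Dalg Y M f -> Dalg X M (T f) ;
  clo_ext : forall f g, Dalg Y M f -> Dalg Y M g ->
    eq_on Y f g -> eq_on X (T f) (T g) ;
  clo_linear : forall (a : R[i]) f g, Dalg Y M f -> Dalg Y M g ->
    eq_on X (T (a *: f + g)) (a *: T f + T g) ;
  clo_compact : forall u, (forall k, Dalg Y M (u k)) ->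
    (exists B : R, forall k, (dnorm Y M (u k) <= B%:E)%E) ->
    exists2 s : nat -> nat, {homo s : i j / (i < j)%N} &
      exists2 g, Dalg X M g & Dcvg_to X M (fun k => T (u (s k))) g }.

End DalesDavie.

(* Main.v *)
Require Import Defs.
From mathcomp Require Import all_boot all_order all_algebra.
From mathcomp Require Import complex.
From mathcomp Require Import all_classical all_reals all_analysis.
From mathcomp Require Import ring lra.
Import numFieldNormedType.Exports.
Import Order.TTheory GRing.Theory Num.Theory.

(** Write [C_f] for the composition [f \o phi]. The theorem rests on one
    estimate: the norm of [C_f] in D(X,M) is at most
    [\sum_k (sup_(phi(X)) |f^(k)| / k!) * N_k], where [N_k] is the norm of the
    [k]-th power of the power series [\sum_(i >= 1) (sup_X |phi^(i)| / i!) T^i]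
    in the weighted l1 algebra of weight [w_n = n! / M_n]. It comes from the
    formula of Faa di Bruno, in the form: the [n]-th Taylor coefficient of
    [C_f] at [x] is the coefficient of [T^n] in
    [\sum_k (f^(k)(phi x) / k!) (P_x)^k], with [P_x] the Taylor series of [phi]
    at [x] minus its constant term ([compose_towerP]). Such formal series need
    not converge to the functions, so this identity is proved by checking that
    the right-hand sides differentiate to each other on [X].

    The axiom of weight sequences says that [w] is submultiplicative, and
    non-analyticity says that [w_n ^ (1/n)] tends to zero, so that the weighted
    algebra is radical: a series without constant term is quasinilpotent, and
    [N_k <= C * e ^ k] for every [e > 0] ([weighted_pcoef_decay]).

    On the other side, [phi(X)] being a compact part of the interior of [Y],
    there is [s > 0] such that the closed discs of radius [s] centred on [phi(X)]
    lie in [Y]. The Cauchy estimates then bound [|f^(k)| / k!] on [phi(X)] by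
    [(8 / s) ^ k] times the supremum of [|f|] ([cauchy_estimate]); they are
    obtained from the maximum principle for difference quotients rather than
    from integrals. Choosing [e = s / 16] makes the series converge
    geometrically, whence [C_f] belongs to D(X,M).

    For compactness, let [u] be a bounded sequence of D(Y,M), and fix an
    ultrafilter on the indices. Along it each derivative [u_n^(k)] is Cauchy,
    pointwise since it is bounded, and uniformly on [phi(X)] by
    equicontinuity. In the estimate above for [f = u_n - u_m] the terms of low
    order are therefore small, and those of high order are small by the Cauchy
    estimates ([compositions_cauchy]). A Cauchy subsequence of the compositions
    is extracted, and it converges because [X] is good. *)

Set Implicit Arguments.
Unset Strict Implicit.
Unset Printing Implicit Defensive.

Local Open Scope classical_set_scope.
Local Open Scope ring_scope.
Local Open Scope complex_scope.

Local Notation normc := Normc.normc.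
Local Notation Re := complex.Re.

(** * The real-valued modulus *)

Section Modulus.
Context {R : realType}.
Implicit Types (z w : R[i]) (r : R).

Lemma normc_norm z : (normc z)%:C = `|z|.
Proof. by case: z. Qed.

Lemma normc_ge0 z : 0 <= normc z.
Proof. by rewrite -lecR normc_norm normr_ge0. Qed.

Lemma normc_gt0 z : (0 < normc z) = (z != 0).
Proof. by rewrite -ltcR normc_norm normr_gt0. Qed.

Lemma normc_triangle z w : normc (z + w) <= normc z + normc w.
Proof. by rewrite -lecR rmorphD /= !normc_norm ler_normD. Qed.

Lemma normc_opp z : normc (- z) = normc z.
Proof. by apply: (@complexI R); rewrite !normc_norm normrN. Qed.

Lemma normc_sub z w : normc (z - w) <= normc z + normc w.
Proof. by rewrite -(normc_opp w) normc_triangle. Qed.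

Lemma normc_distC z w : normc (z - w) = normc (w - z).
Proof. by rewrite -normc_opp opprB. Qed.

Lemma normc_dist_triangle w z z' :
  normc (z - z') <= normc (z - w) + normc (w - z').
Proof. by rewrite (le_trans _ (normc_triangle _ _)) // addrA subrK. Qed.

Lemma normc_exp z n : normc (z ^+ n) = normc z ^+ n.
Proof. by apply: (@complexI R); rewrite rmorphXn /= !normc_norm normrX. Qed.

Lemma normc_real r : normc r%:C = `|r|.
Proof. by rewrite /= expr0n /= addr0 sqrtr_sqr. Qed.

Lemma normc_nat n : normc (n%:R : R[i]) = n%:R.
Proof. by apply: (@complexI R); rewrite normc_norm normr_nat rmorph_nat. Qed.

Lemma Re_le_normc z : Re z <= normc z.
Proof.
rewrite (le_trans (ler_norm _))//.
by rewrite -lecR normc_norm normc_ge_Re.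
Qed.

Lemma Re_ge_normc z : - normc z <= Re z.
Proof. by rewrite lerNl -raddfN /= -normc_opp Re_le_normc. Qed.

Lemma normc_sum (I : Type) (s : seq I) (P : pred I) (F : I -> R[i]) :
  normc (\sum_(i <- s | P i) F i) <= \sum_(i <- s | P i) normc (F i).
Proof.
elim/big_ind2 : _ => [|x r y q hx hy|//]; first by rewrite Normc.normc0.
by rewrite (le_trans (normc_triangle _ _))// lerD.
Qed.

(** Rotating [z] onto the positive real axis reduces statements on moduli to
    statements on real parts. *)
Lemma normc_rotation z : exists2 c : R[i], normc c = 1 & Re (c * z) = normc z.
Proof.
have [->|z0] := eqVneq z 0.
  by exists 1; rewrite ?Normc.normc1// mulr0 Normc.normc0.
exists (`|z| / z).
  rewrite Normc.normcM Normc.normcV -normc_norm normc_real.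
  by rewrite ger0_norm ?normc_ge0// divff// gt_eqF// normc_gt0.
by rewrite divfK// -normc_norm.
Qed.

Lemma nbhs_normcP (a : R[i]) (A : set R[i]) :
  nbhs a A <-> exists2 d : R, 0 < d & forall z, normc (z - a) < d -> A z.
Proof.
split.
  move=> /nbhs_ballP[e /= e0 eA].
  have ee : e = (Re e)%:C by rewrite RRe_real// gtr0_real.
  have e0' : 0 < Re e by rewrite -ltcR -ee.
  exists (Re e) => // z za; apply: eA; rewrite -ball_normE /=.
  by rewrite distrC -normc_norm ee ltcR.
move=> [d d0 dA]; apply/nbhs_ballP; exists d%:C; first by rewrite /= ltcR.
move=> z; rewrite -ball_normE /= distrC -normc_norm ltcR; exact: dA.
Qed.

Lemma within_dnbhs_normcP (X : set R[i]) (a : R[i]) (A : set R[i]) :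
  within X a^' A <-> exists2 d : R, 0 < d &
    forall z, X z -> z != a -> normc (z - a) < d -> A z.
Proof.
rewrite /within /dnbhs /within /=.
split => [/nbhs_normcP[d d0 dA]|[d d0 dA]].
  by exists d => // z Xz za zd; apply: dA.
by apply/nbhs_normcP; exists d => // z zd za Xz; apply: dA.
Qed.

Lemma limit_point_within_proper (X : set R[i]) (a : R[i]) :
  limit_point X a -> ProperFilter (within X a^').
Proof.
move=> Xa; apply: Build_ProperFilter_ex => P.
by move=> /within_dnbhs_normcP [d d0 dP];
  have [|y [ya Xy yd]] := Xa [set z | normc (z - a) < d];
  [apply/nbhs_normcP; exists d | exists y; exact: dP].
Qed.

End Modulus.

(** * Derivatives relative to a subset of the plane *)

Section Derivative.
Context {R : realType}.
Implicit Types (X Y : set R[i]) (f g : R[i] -> R[i]) (a d : R[i]).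

(** The first order expansion includes [z = a], so that it composes without
    a case distinction on the coincidences [f z = f a]. *)
Definition has_cderiv X f a d := forall e : R, 0 < e ->
  exists2 r : R, 0 < r & forall z, X z -> normc (z - a) < r ->
    normc (f z - f a - d * (z - a)) <= e * normc (z - a).

Lemma has_cderivP X f a d :
  has_cderiv X f a d <-> (f z - f a) / (z - a) @[z --> within X a^'] --> d.
Proof.
have quot z : z != a ->
    normc ((f z - f a) / (z - a) - d) * normc (z - a) =
    normc (f z - f a - d * (z - a)).
  by move=> za; rewrite -Normc.normcM mulrBl divfK ?subr_eq0.
split=> [fd A /nbhs_normcP[e e0 eA]|fd e e0].
  have [r r0 rf] := fd (e / 2) (divr_gt0 e0 (ltr0Sn _ 1)).
  apply/within_dnbhs_normcP; exists r => // z Xz za zr; apply: eA.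
  have zpos : 0 < normc (z - a) by rewrite normc_gt0 subr_eq0.
  rewrite (@le_lt_trans _ _ (e / 2))//; last by rewrite ltr_pdivrMr// ltr_pMr// ltr1n.
  by rewrite -(ler_pM2r zpos) quot// rf.
have /fd/within_dnbhs_normcP[r r0 rf] : nbhs d [set w | normc (w - d) < e].
  by apply/nbhs_normcP; exists e.
exists r => // z Xz zr; have [->|za] := eqVneq z a.
  by rewrite !subrr mulr0 subrr Normc.normc0 mulr0.
by rewrite -quot// ler_wpM2r ?normc_ge0// ltW// rf.
Qed.

Lemma cderiv_has X f a :
  complex_differentiable X f a -> has_cderiv X f a (cderiv X f a).
Proof. by move=> fa; apply/has_cderivP. Qed.

Lemma has_cderiv_unique X f a d : limit_point X a -> has_cderiv X f a d ->
  complex_differentiable X f a /\ cderiv X f a = d.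
Proof.
move=> /limit_point_within_proper pX /has_cderivP fd.
by split; [apply: cvgP fd | apply: cvg_lim fd; exact: norm_hausdorff].
Qed.

Lemma eq_has_cderiv X f g a d : X a -> eq_on X f g ->
  has_cderiv X f a d -> has_cderiv X g a d.
Proof.
move=> Xa fg fd e /fd[r r0 rf]; exists r => // z Xz zr.
by rewrite -!fg// rf.
Qed.

Lemma has_cderiv_cst X (c : R[i]) a : has_cderiv X (fun=> c) a 0.
Proof.
move=> e e0; exists 1 => // z _ _.
by rewrite subrr mul0r subrr Normc.normc0 mulr_ge0 ?normc_ge0// ltW.
Qed.

Lemma has_cderiv_id X a : has_cderiv X id a 1.
Proof.
move=> e e0; exists 1 => // z _ _.
by rewrite mul1r subrr Normc.normc0 mulr_ge0 ?normc_ge0// ltW.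
Qed.

Lemma has_cderivD X f g a d d' : has_cderiv X f a d -> has_cderiv X g a d' ->
  has_cderiv X (fun z => f z + g z) a (d + d').
Proof.
move=> fd gd e e0; have e2 : 0 < e / 2 by rewrite divr_gt0.
have [r r0 rf] := fd _ e2; have [s s0 sg] := gd _ e2.
exists (Num.min r s); first by rewrite lt_min r0.
move=> z Xz; rewrite lt_min => /andP[zr zs].
have -> : f z + g z - (f a + g a) - (d + d') * (z - a) =
  (f z - f a - d * (z - a)) + (g z - g a - d' * (z - a)) by ring.
rewrite (le_trans (normc_triangle _ _))// (splitr e) mulrDl.
by rewrite lerD ?rf ?sg.
Qed.

(** This crude bound gives continuity and controls the remainders in the
    product and chain rules. *)
Lemma has_cderiv_lipschitz X f a d : has_cderiv X f a d ->
  exists2 r : R, 0 < r & forall z, X z -> normc (z - a) < r ->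
    normc (f z - f a) <= (normc d + 1) * normc (z - a).
Proof.
move=> /(_ 1 ltr01)[r r0 rf]; exists r => // z Xz zr.
have -> : f z - f a = d * (z - a) + (f z - f a - d * (z - a)) by ring.
rewrite (le_trans (normc_triangle _ _))// mulrDl Normc.normcM lerD2l.
exact: rf.
Qed.

Lemma has_cderiv_continuous X f a d : has_cderiv X f a d ->
  forall e : R, 0 < e -> exists2 r : R, 0 < r &
    forall z, X z -> normc (z - a) < r -> normc (f z - f a) < e.
Proof.
move=> /has_cderiv_lipschitz[r r0 rf] e e0.
have d1 : 0 < normc d + 1 by rewrite ltr_wpDl ?normc_ge0.
exists (Num.min r (e / (normc d + 1))); first by rewrite lt_min r0 divr_gt0.
move=> z Xz; rewrite lt_min => /andP[zr ze].
by rewrite (le_lt_trans (rf _ Xz zr))// mulrC -ltr_pdivlMr.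
Qed.

Lemma has_cderivM X f g a d d' : has_cderiv X f a d -> has_cderiv X g a d' ->
  has_cderiv X (fun z => f z * g z) a (d * g a + f a * d').
Proof.
move=> fd gd e e0.
set c := normc (f a) + normc (g a) + normc d + 1.
have c0 : 0 < c by rewrite ltr_wpDl// !addr_ge0 ?normc_ge0.
have ce : 0 < e / (3 * c) by rewrite divr_gt0// mulr_gt0.
have [r r0 rf] := fd _ ce; have [s s0 sg] := gd _ ce.
have [s' s'0 sg'] := has_cderiv_continuous gd ce.
have [r' r'0 rf'] := has_cderiv_lipschitz fd.
exists (Num.min (Num.min r s) (Num.min r' s')); first by rewrite !lt_min r0 s0 r'0.
move=> z Xz; rewrite !lt_min => /andP[/andP[zr zs] /andP[zr' zs']].
have {}rf := rf _ Xz zr; have {}sg := sg _ Xz zs.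
have {}rf' := rf' _ Xz zr'; have {}sg' := ltW (sg' _ Xz zs').
have -> : f z * g z - f a * g a - (d * g a + f a * d') * (z - a) =
  (f z - f a - d * (z - a)) * g a + f a * (g z - g a - d' * (z - a))
  + (f z - f a) * (g z - g a) by ring.
set n := normc (z - a) in rf sg rf' *.
have n0 : 0 <= n := normc_ge0 _.
have ec : e / (3 * c) * c = e / 3 by rewrite invfM; field; rewrite gt_eqF.
have third u v : normc u <= e / (3 * c) * n -> normc v <= c ->
    normc (u * v) <= e / 3 * n.
  move=> hu hv; rewrite Normc.normcM -ec mulrAC.
  by rewrite ler_pM ?normc_ge0.
have -> : e * n = e / 3 * n + e / 3 * n + e / 3 * n by field.
have fa0 := normc_ge0 (f a); have ga0 := normc_ge0 (g a).
have d0 := normc_ge0 d.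
have cf : normc (f a) <= c by rewrite /c; lra.
have cg : normc (g a) <= c by rewrite /c; lra.
rewrite (le_trans (normc_triangle _ _))// lerD//.
  rewrite (le_trans (normc_triangle _ _))// lerD//; first exact: third.
  by rewrite [f a * _]mulrC third.
rewrite Normc.normcM -ec.
rewrite (@le_trans _ _ ((c * n) * (e / (3 * c))))//; last by rewrite le_eqVlt; apply/orP; left; apply/eqP; ring.
rewrite ler_pM ?normc_ge0// (le_trans rf')// ler_wpM2r//.
by rewrite /c; lra.
Qed.

Lemma has_cderivZ X f a d (c : R[i]) : has_cderiv X f a d ->
  has_cderiv X (fun z => c * f z) a (c * d).
Proof.
move=> fd; have := has_cderivM (has_cderiv_cst X c a) fd.
by rewrite mul0r add0r.
Qed.

Lemma has_cderivB X f g a d d' : has_cderiv X f a d -> has_cderiv X g a d' ->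
  has_cderiv X (fun z => f z - g z) a (d - d').
Proof.
move=> fd /(has_cderivZ (-1)) /(has_cderivD fd); rewrite mulN1r.
have -> // : (fun z => f z - g z) = (fun z => f z + -1 * g z).
by apply/funext => z; rewrite mulN1r.
Qed.

Lemma has_cderiv_sum X n (F : nat -> R[i] -> R[i]) a (D : nat -> R[i]) :
  (forall i, (i < n)%N -> has_cderiv X (F i) a (D i)) ->
  has_cderiv X (fun z => \sum_(i < n) F i z) a (\sum_(i < n) D i).
Proof.
elim: n => [|n IH] FD.
  rewrite big_ord0; under [X in has_cderiv _ X]eq_fun do rewrite big_ord0.
  exact: has_cderiv_cst.
rewrite big_ord_recr; under [X in has_cderiv _ X]eq_fun do rewrite big_ord_recr.
by apply: has_cderivD; [apply: IH => i /ltnW/FD | apply: FD].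
Qed.

Lemma has_cderiv_comp X Y f g a d d' : (forall x, X x -> Y (g x)) ->
  has_cderiv X g a d -> has_cderiv Y f (g a) d' ->
  has_cderiv X (fun z => f (g z)) a (d' * d).
Proof.
move=> XY gd fd e e0.
set c := normc d + normc d' + 1.
have c0 : 0 < c by rewrite ltr_wpDl// addr_ge0 ?normc_ge0.
have ce : 0 < e / (2 * c) by rewrite divr_gt0// mulr_gt0.
have [r r0 rg] := gd _ ce; have [s s0 sf] := fd _ ce.
have [s' s'0 sg'] := has_cderiv_continuous gd s0.
have [r' r'0 rg'] := has_cderiv_lipschitz gd.
exists (Num.min r (Num.min r' s')); first by rewrite !lt_min r0 r'0.
move=> z Xz; rewrite !lt_min => /andP[zr /andP[zr' zs']].
have {}rg := rg _ Xz zr; have {}rg' := rg' _ Xz zr'.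
have {}sf := sf _ (XY _ Xz) (sg' _ Xz zs').
have -> : f (g z) - f (g a) - d' * d * (z - a) =
  (f (g z) - f (g a) - d' * (g z - g a)) + d' * (g z - g a - d * (z - a)) by ring.
set n := normc (z - a) in rg rg' *.
have n0 : 0 <= n := normc_ge0 _.
have ec : e / (2 * c) * c = e / 2 by rewrite invfM; field; rewrite gt_eqF.
have -> : e * n = e / 2 * n + e / 2 * n by field.
rewrite (le_trans (normc_triangle _ _))// lerD//.
  rewrite (le_trans sf)// -ec -[leRHS]mulrA; apply: ler_wpM2l; first exact: ltW.
  rewrite (le_trans rg')// ler_wpM2r//.
  by rewrite /c addrAC lerDl normc_ge0.
rewrite Normc.normcM -ec mulrAC mulrC ler_pM ?normc_ge0//.
by rewrite /c addrAC lerDr addr_ge0 ?normc_ge0.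
Qed.

(** Higher derivatives are handled through such sequences because explicit
    formulas produce them directly; [tower_cderivn] identifies them with the
    iterates of [cderiv]. *)
Definition derivative_tower X (F : nat -> R[i] -> R[i]) :=
  forall n a, X a -> has_cderiv X (F n) a (F n.+1 a).

Lemma cderivn_tower X f : infinitely_differentiable X f ->
  derivative_tower X (fun n => cderivn X n f).
Proof. by move=> fX n a Xa; exact/cderiv_has/fX. Qed.

(** Perfectness makes derivatives unique, whence the tower above [f] is the
    sequence of derivatives of [f]. *)
Lemma tower_cderivn X F f : X `<=` limit_point X -> derivative_tower X F ->
  eq_on X f (F 0%N) ->
  infinitely_differentiable X f /\ forall n, eq_on X (cderivn X n f) (F n).
Proof.
move=> Xl FT fF.
have FE n : eq_on X (cderivn X n f) (F n).
  elim: n => [//|n IH] a Xa /=.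
  have h : has_cderiv X (cderivn X n f) a (F n.+1 a).
    by apply: eq_has_cderiv (FT n a Xa) => // z Xz; rewrite IH.
  by case: (has_cderiv_unique (Xl _ Xa) h).
split=> // n a Xa.
have h : has_cderiv X (cderivn X n f) a (F n.+1 a).
  by apply: eq_has_cderiv (FT n a Xa) => // z Xz; rewrite FE.
by case: (has_cderiv_unique (Xl _ Xa) h).
Qed.

Lemma tower_shift X F k : derivative_tower X F ->
  derivative_tower X (fun n => F (n + k)%N).
Proof. by move=> FT n a Xa; rewrite addSn; exact: FT. Qed.

End Derivative.


(** * Mean value inequality and Taylor expansions *)

Section Taylor.
Context {R : realType}.
Implicit Types (Y : set R[i]) (f g : R[i] -> R[i]) (p q z w h : R[i]).

Lemma ReB z w : Re (z - w) = Re z - Re w.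
Proof. by rewrite raddfB. Qed.

Lemma Re_realM (x : R) z : Re (x%:C * z) = x * Re z.
Proof. by case: z => a b /=; rewrite mul0r subr0. Qed.

Lemma is_derive_expansion (G : R -> R) (t L : R) :
  (forall e : R, 0 < e -> exists2 r : R, 0 < r & forall u, `|u - t| < r ->
     `|G u - G t - L * (u - t)| <= e * `|u - t|) ->
  is_derive t 1 G L.
Proof.
move=> GL.
suff GD : h^-1 *: (G (h *: 1 + t) - G t) @[h --> 0^'] --> L.
  by apply: DeriveDef; [exact: cvgP GD | exact: cvg_lim GD].
apply/cvgrPdist_le => e e0; have [r r0 rG] := GL e e0.
rewrite near_withinE; apply/nbhs_ballP; exists r => //= u.
rewrite -ball_normE /= sub0r normrN => ur u0.
have := rG (u + t); rewrite addrK => /(_ ur) H.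
have un0 : 0 < `|u| by rewrite normr_gt0.
rewrite -(ler_pM2r un0) -normrM (le_trans _ H)//.
rewrite -normrN le_eqVlt; apply/orP; left; apply/eqP; congr `|_|.
by rewrite /GRing.scale /= mulr1; field.
Qed.

(** The mean value theorem for the real part along the segment from [p] to
    [z], after a rotation making the increment of [F] a positive real. *)
Lemma mean_value_inequality Y (F D : R[i] -> R[i]) p (r C : R) n :
  0 <= C -> (forall z, normc (z - p) < r -> Y z) ->
  (forall z, normc (z - p) < r -> has_cderiv Y F z (D z)) ->
  (forall z, normc (z - p) < r -> normc (D z) <= C * normc (z - p) ^+ n) ->
  forall z, normc (z - p) < r -> normc (F z - F p) <= C * normc (z - p) ^+ n.+1.
Proof.
move=> C0 pY FD DC z zr.
have [c c1 cE] := normc_rotation (F z - F p).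
set h := z - p in zr *.
pose y (t : R) := p + t%:C * h.
have yp t : normc (y t - p) = `|t| * normc h.
  by rewrite /y addrAC subrr add0r Normc.normcM normc_real.
have yr (t : R) : 0 <= t <= 1 -> normc (y t - p) < r.
  move=> /andP[t0 t1]; rewrite yp ger0_norm// (le_lt_trans _ zr)//.
  by rewrite ler_piMl ?normc_ge0.
pose G t := Re (c * F (y t)).
have GD (t : R) : 0 <= t <= 1 -> is_derive t 1 G (Re (c * (D (y t) * h))).
  move=> t01; apply: is_derive_expansion => e e0.
  have h1 : 0 < normc h + 1 by rewrite ltr_wpDl ?normc_ge0.
  have [d d0 dF] := FD _ (yr _ t01) (e / (normc h + 1)) (divr_gt0 e0 h1).
  pose m := r - normc (y t - p).
  have m0 : 0 < m by rewrite subr_gt0 yr.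
  exists (Num.min d m / (normc h + 1)).
    by rewrite divr_gt0// lt_min d0.
  move=> u; rewrite ltr_pdivlMr// lt_min => /andP[ud um].
  have yut : y u - y t = (u - t)%:C * h by rewrite /y rmorphB /=; ring.
  have nyut : normc (y u - y t) = `|u - t| * normc h.
    by rewrite yut Normc.normcM normc_real.
  have le1 : normc (y u - y t) <= `|u - t| * (normc h + 1).
    by rewrite nyut ler_wpM2l// lerDl.
  have Yu : Y (y u).
    apply: pY; rewrite (le_lt_trans (normc_dist_triangle (y t) _ _))//.
    by rewrite -ltrBrDr (le_lt_trans le1).
  have := dF _ Yu (le_lt_trans le1 ud).
  set w := (X in normc X) => wle.
  have -> : G u - G t - Re (c * (D (y t) * h)) * (u - t) = Re (c * w).
    have -> : c * w = c * F (y u) - c * F (y t)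
                      - (u - t)%:C * (c * (D (y t) * h)).
      by rewrite /w yut; ring.
    by rewrite !ReB Re_realM [_ * (u - t)]mulrC.
  have cw : normc (c * w) <= e * `|u - t|.
    rewrite Normc.normcM c1 mul1r (le_trans wle)//.
    rewrite -mulrA ler_wpM2l ?(ltW e0)// ler_pdivrMl// mulrC.
    by rewrite (le_trans le1)// mulrC.
  rewrite ler_norml; apply/andP; split.
    by rewrite (le_trans _ (Re_ge_normc _))// lerN2.
  by rewrite (le_trans (Re_le_normc _)).
have G01 : {within `[0, 1], continuous G}.
  apply: continuous_in_subspaceT => t; rewrite inE /= in_itv /= => t01.
  apply: differentiable_continuous; apply/derivable1_diffP.
  by have [] := GD t t01.
have [t] := MVT ltr01 (fun t (t01 : t \in `]0, 1[%R) =>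
  GD t (subset_itv_oo_cc t01)) G01.
rewrite in_itv /= => /andP[t0 t1]; rewrite subr0 mulr1.
have -> : G 1 - G 0 = normc (F z - F p).
  rewrite -cE mulrBr ReB /G /y rmorph1 rmorph0 mul1r mul0r addr0.
  by have -> : p + h = z by rewrite /h addrC subrK.
move=> ->; rewrite (le_trans (Re_le_normc _))// !Normc.normcM c1 mul1r.
rewrite exprSr mulrA ler_wpM2r ?normc_ge0//.
have tt : 0 <= t <= 1 by rewrite !ltW.
rewrite (le_trans (DC _ (yr _ tt)))// yp.
apply: ler_wpM2l => //; apply: lerXn2r; rewrite ?nnegrE ?mulr_ge0 ?normc_ge0//.
by rewrite ger0_norm ?ler_piMl ?normc_ge0// ltW.
Qed.

Lemma has_cderiv_monomial Y p z (c : R[i]) n :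
  has_cderiv Y (fun w => c * (w - p) ^+ n) z (c * ((z - p) ^+ n.-1 *+ n)).
Proof.
apply: has_cderivZ.
elim: n => [|n IH].
  by rewrite mulr0n; under [X in has_cderiv _ X]eq_fun do rewrite expr0;
    exact: has_cderiv_cst.
have sub1 : has_cderiv Y (fun w => w - p) z 1.
  have := has_cderivD (has_cderiv_id Y z) (has_cderiv_cst Y (- p) z).
  by rewrite addr0.
under [X in has_cderiv _ X]eq_fun do rewrite exprS.
have := has_cderivM sub1 IH; rewrite mul1r /=.
case: n {IH} => [|n] /=; first by rewrite mulr0n mulr0 addr0 expr0 mulr1n.
by rewrite mulrnAr -exprS -mulrS.
Qed.

(** Induction on the order: the derivative of the remainder of [F 0] is the
    remainder of lower order of [F 1]. *)
Lemma taylor_remainder Y (F : nat -> R[i] -> R[i]) p (r C : R) n :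
  0 <= C -> (forall z, normc (z - p) < r -> Y z) -> derivative_tower Y F ->
  (forall z, normc (z - p) < r -> normc (F n z) <= C) ->
  forall z, normc (z - p) < r ->
    normc (F 0%N z - \sum_(j < n) F j p / j`!%:R * (z - p) ^+ j)
    <= C * normc (z - p) ^+ n.
Proof.
move=> C0 pY; elim: n F => [|n IH] F FT FC z zr.
  by rewrite big_ord0 subr0 expr0 mulr1 FC.
pose H w := F 0%N w - \sum_(j < n.+1) F j p / j`!%:R * (w - p) ^+ j.
pose D w := F 1%N w - \sum_(j < n) F j.+1 p / j`!%:R * (w - p) ^+ j.
have HD w : normc (w - p) < r -> has_cderiv Y H w (D w).
  move=> wr; apply: has_cderivB; first exact/FT/pY.
  have -> : \sum_(j < n) F j.+1 p / j`!%:R * (w - p) ^+ j =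
      \sum_(j < n.+1) F j p / j`!%:R * ((w - p) ^+ j.-1 *+ j).
    rewrite big_ord_recl /= mulr0n mulr0 add0r; apply: eq_bigr => j _.
    rewrite /bump /= add1n factS natrM -mulr_natl.
    have j0 : (j.+1%:R : R[i]) != 0 by rewrite pnatr_eq0.
    have jf0 : (j`!%:R : R[i]) != 0 by rewrite pnatr_eq0 -lt0n fact_gt0.
    by field; rewrite jf0 addrC natr1 j0.
  apply: (has_cderiv_sum (F := fun j w => F j p / j`!%:R * (w - p) ^+ j)
    (D := fun j => F j p / j`!%:R * ((w - p) ^+ j.-1 *+ j))) => i _.
  exact: has_cderiv_monomial.
have Hp : H p = 0.
  rewrite /H big_ord_recl /= fact0 divr1 expr0 mulr1 big1 ?addr0 ?subrr//.
  by move=> j _; rewrite expr0n /= mulr0.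
have := mean_value_inequality C0 pY HD _ zr; rewrite Hp subr0; apply => w wr.
by apply: (IH (fun j => F j.+1)) => // j a Ya; exact: FT.
Qed.

(** Averaging over the four directions [1, i, -1, -i] kills the terms of
    degree one and two. *)
Lemma four_point_sum g q (a1 a2 : R[i]) (K r t : R) :
  (forall h, normc h < r ->
    normc (g (q + h) - (g q + a1 * h + a2 * h ^+ 2)) <= K * normc h ^+ 3) ->
  0 < t -> t < r ->
  normc (g (q + t%:C) + g (q + 'i * t%:C) + g (q - t%:C) + g (q - 'i * t%:C)
         - 4 * g q) <= 4 * K * t ^+ 3.
Proof.
move=> gE t0 tr.
have ni : normc ('i : R[i]) = 1 by rewrite /= expr0n expr1n add0r sqrtr1.
have nt : normc t%:C = t by rewrite normc_real gtr0_norm.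
have nit : normc ('i * t%:C) = t by rewrite Normc.normcM ni nt mul1r.
have E1 := gE t%:C; have E2 := gE ('i * t%:C).
have E3 := gE (- t%:C); have E4 := gE (- ('i * t%:C)).
move: E1 E2 E3 E4; rewrite !normc_opp nit nt => /(_ tr) E1 /(_ tr) E2 /(_ tr) E3 /(_ tr) E4.
set x1 := g (q + t%:C) - _ in E1; set x2 := g (q + 'i * t%:C) - _ in E2.
set x3 := g (q - t%:C) - _ in E3; set x4 := g (q - 'i * t%:C) - _ in E4.
have ii : ('i : R[i]) ^+ 2 = -1 := sqr_i R.
have -> : g (q + t%:C) + g (q + 'i * t%:C) + g (q - t%:C) + g (q - 'i * t%:C)
         - 4 * g q = x1 + x2 + x3 + x4.
  by rewrite /x1 /x2 /x3 /x4 !sqrrN !exprMn !ii; ring.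
have -> : 4 * K * t ^+ 3 = K * t ^+ 3 + K * t ^+ 3 + K * t ^+ 3 + K * t ^+ 3.
  by ring.
by do 3 (rewrite (le_trans (normc_triangle _ _))// lerD//).
Qed.

End Taylor.

(** * The maximum principle *)

Section MaximumPrinciple.
Context {R : realType}.
Implicit Types (Y : set R[i]) (f g : R[i] -> R[i]) (p q z h : R[i]).

Definition closed_disc p (s : R) : set R[i] := [set z | normc (z - p) <= s].

Lemma closed_disc_closed p s : closed (closed_disc p s).
Proof.
rewrite -openC openE => z /= /negP; rewrite -ltNge => zs.
apply/nbhs_normcP; exists (normc (z - p) - s); first by rewrite subr_gt0.
move=> w wz /= ws.
have := normc_dist_triangle w z p; rewrite (normc_distC z w) leNgt => /negP; apply.
by rewrite -ltrBrDr; move: wz ws; rewrite /closed_disc /=; lra.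
Qed.

Lemma sqr_normc_Re_Im z : normc z ^+ 2 = Re z ^+ 2 + complex.Im z ^+ 2.
Proof. by case: z => a b /=; rewrite sqr_sqrtr// addr_ge0 ?sqr_ge0. Qed.

(** The real part of a rotation of [g] plus a small multiple of [|z - p|^2]
    has positive discrete Laplacian at interior points, so it attains its
    maximum on the boundary circle. *)
Lemma maximum_principle g p (s B : R) : compact (closed_disc p s) -> 0 < s ->
  (forall q, closed_disc p s q -> forall e : R, 0 < e -> exists2 r : R, 0 < r &
     forall w, closed_disc p s w -> normc (w - q) < r -> normc (g w - g q) < e) ->
  (forall q, normc (q - p) < s -> exists a1 a2 : R[i], exists K r : R,
     0 < r /\ forall h, normc h < r ->
     normc (g (q + h) - (g q + a1 * h + a2 * h ^+ 2)) <= K * normc h ^+ 3) ->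
  (forall z, normc (z - p) = s -> normc (g z) <= B) ->
  forall z, closed_disc p s z -> normc (g z) <= B.
Proof.
move=> sc s0 gc gE gB z0 z0s; rewrite leNgt; apply/negP => Bz0.
have [c c1 cE] := normc_rotation (g z0).
(* [eps] is so small that the added term uses up only half of the gap between
   [B] and the value at [z0]. *)
pose eps := (normc (g z0) - B) / (2 * s ^+ 2).
have s20 : 0 < s ^+ 2 by rewrite exprn_gt0.
have eps0 : 0 < eps by rewrite divr_gt0 ?subr_gt0// mulr_gt0.
pose N z := (Re z - Re p) ^+ 2 + (complex.Im z - complex.Im p) ^+ 2.
have NE z : N z = normc (z - p) ^+ 2 by rewrite sqr_normc_Re_Im !raddfB.
pose v z := Re (c * g z) + eps * N z.
have vc : {within closed_disc p s, continuous v}.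
  apply/subspace_continuousP => q qs.
  apply/cvgrPdist_lt => e e0.
  have e2 : 0 < e / 2 by rewrite divr_gt0.
  have k0 : 0 < 2 * eps * (2 * s) by do 2!apply: mulr_gt0.
  have [r r0 rg] := gc _ qs _ e2.
  apply/nbhs_normcP; exists (Num.min r (e / (2 * eps * (2 * s)))).
    by rewrite lt_min r0 divr_gt0.
  move=> w; rewrite lt_min => /andP[wr we] /= ws.
  have := rg _ ws wr.
  have -> : v q - v w = - Re (c * (g w - g q)) + eps * (N q - N w).
    by rewrite /v mulrBr raddfB /=; ring.
  move=> gwq.
  rewrite (le_lt_trans (ler_normD _ _))// (splitr e) ltr_leD//.
    rewrite normrN ltr_norml.
    have := Re_le_normc (c * (g w - g q)); have := Re_ge_normc (c * (g w - g q)).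
    by rewrite Normc.normcM c1 mul1r; lra.
  rewrite normrM gtr0_norm// !NE.
  have -> : normc (q - p) ^+ 2 - normc (w - p) ^+ 2 =
    (normc (q - p) - normc (w - p)) * (normc (q - p) + normc (w - p)) by ring.
  rewrite normrM [`|normc (q - p) + normc (w - p)|]ger0_norm ?addr_ge0 ?normc_ge0//.
  have d1 : `|normc (q - p) - normc (w - p)| <= normc (w - q).
    have h1 := normc_dist_triangle w q p; have h2 := normc_dist_triangle q w p.
    by move: h1; rewrite (normc_distC q w) ler_norml => h1; lra.
  have d2 : normc (q - p) + normc (w - p) <= 2 * s.
    by move: qs ws; rewrite /closed_disc /=; lra.
  rewrite (@le_trans _ _ (eps * (normc (w - q) * (2 * s))))//.
    apply: ler_wpM2l; first exact: ltW.
    by apply: ler_pM d1 d2; rewrite ?normr_ge0// addr_ge0 ?normc_ge0.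
  move: we; rewrite ltr_pdivlMr//; lra.
have [|q] := compact_EVT_max _ sc vc; first by exists z0.
rewrite inE => qs vmax.
have vz0 : normc (g z0) <= v q.
  rewrite (le_trans _ (vmax z0 _)) ?inE// /v cE lerDl mulr_ge0 ?(ltW eps0)//.
  by rewrite NE exprn_ge0 ?normc_ge0.
have := qs; rewrite /closed_disc /= le_eqVlt => /orP[/eqP qps|qps].
  have : v q <= B + eps * s ^+ 2.
    rewrite /v NE qps lerD2r (le_trans (Re_le_normc _))// Normc.normcM c1 mul1r.
    exact: gB.
  have -> : eps * s ^+ 2 = (normc (g z0) - B) / 2.
    by rewrite /eps; field; rewrite gt_eqF.
  lra.
have [a1 [a2 [K [r [r0 rE]]]]] := gE _ qps.
pose K' := Num.max K 0 + 1.
have K0 : 0 < K' by rewrite ltr_wpDl// le_max lexx orbT.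
(* At step [t] the gain [4 eps t^2] beats the error [4 K' t^3]. *)
pose t := Num.min (Num.min (r / 2) (s - normc (q - p))) (eps / (2 * K')).
have t0 : 0 < t.
  by rewrite !lt_min subr_gt0 qps (divr_gt0 r0)// (divr_gt0 eps0)// mulr_gt0.
have tr : t < r.
  by rewrite (@le_lt_trans _ _ (r / 2))// ?ge_min ?lexx//; lra.
have tsq : t <= s - normc (q - p) by rewrite /t !ge_min lexx orbT.
have tK : t * (2 * K') <= eps.
  by rewrite -ler_pdivlMr ?mulr_gt0// /t !ge_min lexx orbT.
have rE' h : normc h < r ->
    normc (g (q + h) - (g q + a1 * h + a2 * h ^+ 2)) <= K' * normc h ^+ 3.
  move=> /rE/le_trans; apply; rewrite ler_wpM2r ?exprn_ge0 ?normc_ge0//.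
  by rewrite /K' (@le_trans _ _ (Num.max K 0))// ?le_max ?lexx// lerDl.
have := four_point_sum rE' t0 tr.
set S := (X in normc X) => Sle.
have in_disc h : normc h = t -> v (q + h) <= v q.
  move=> ht; apply: vmax; rewrite inE /closed_disc /=.
  rewrite addrAC (le_trans (normc_triangle _ _))// ht; lra.
have nt : normc t%:C = t by rewrite normc_real gtr0_norm.
have nit : normc ('i * t%:C) = t.
  by rewrite Normc.normcM nt /= expr0n expr1n add0r sqrtr1 mul1r.
have V1 := in_disc _ nt; have V2 := in_disc _ nit.
have V3 : v (q - t%:C) <= v q by apply: in_disc; rewrite normc_opp.
have V4 : v (q - 'i * t%:C) <= v q by apply: in_disc; rewrite normc_opp.
have NS : N (q + t%:C) + N (q + 'i * t%:C) + N (q - t%:C) + N (q - 'i * t%:C)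
    = 4 * N q + 4 * t ^+ 2.
  rewrite /N; case: (q) => a b /=; ring.
have VS : v (q + t%:C) + v (q + 'i * t%:C) + v (q - t%:C) + v (q - 'i * t%:C)
    = 4 * v q + Re (c * S) + 4 * eps * t ^+ 2.
  have -> : c * S = c * g (q + t%:C) + c * g (q + 'i * t%:C) + c * g (q - t%:C)
    + c * g (q - 'i * t%:C)
    - (c * g q + c * g q + c * g q + c * g q) by rewrite /S; ring.
  rewrite raddfB !raddfD /= /v.
  have -> : 4 * eps * t ^+ 2 = eps * (4 * N q + 4 * t ^+ 2) - 4 * eps * N q by ring.
  by rewrite -NS; ring.
have RS : - (4 * K' * t ^+ 3) <= Re (c * S).
  by rewrite (le_trans _ (Re_ge_normc _))// Normc.normcM c1 mul1r lerN2.
have t2 : 0 < t ^+ 2 by rewrite exprn_gt0.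
have : 4 * K' * t ^+ 3 <= 2 * eps * t ^+ 2.
  have -> : 4 * K' * t ^+ 3 = 2 * (t * (2 * K')) * t ^+ 2 by ring.
  by rewrite ler_wpM2r ?(ltW t2)// ler_wpM2l.
have : 0 < eps * t ^+ 2 by rewrite mulr_gt0.
lra.
Qed.

End MaximumPrinciple.


(** * Cauchy estimates *)

Section CauchyEstimates.
Context {R : realType}.
Implicit Types (Y : set R[i]) (F : nat -> R[i] -> R[i]) (p q z h : R[i]).

Lemma taylor_expansion Y F q (rho : R) n : 0 < rho ->
  (forall z, normc (z - q) < rho -> Y z) -> derivative_tower Y F ->
  exists C r : R, [/\ 0 <= C, 0 < r & forall h, normc h < r ->
    normc (F 0%N (q + h) - \sum_(j < n) F j q / j`!%:R * h ^+ j)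
    <= C * normc h ^+ n].
Proof.
move=> rho0 qY FT.
have Yq : Y q by apply: qY; rewrite subrr Normc.normc0.
have [d d0 dF] := has_cderiv_continuous (FT n q Yq) ltr01.
have C0 : 0 <= normc (F n q) + 1 by rewrite addr_ge0 ?normc_ge0.
have r0 : 0 < Num.min rho d by rewrite lt_min rho0.
exists (normc (F n q) + 1), (Num.min rho d); split => // h hr.
have hE : q + h - q = h by rewrite addrAC subrr add0r.
have := @taylor_remainder _ Y F q (Num.min rho d) _ n C0 _ FT _ (q + h).
rewrite hE; apply => // z; rewrite lt_min => /andP[zrho zd]; first exact: qY.
rewrite -[F n z](subrK (F n q)) (le_trans (normc_triangle _ _))// addrC.
by rewrite lerD2l ltW// dF//; exact: qY.
Qed.

Definition difference_quotient F p z :=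
  if z == p then F 1%N p else (F 0%N z - F 0%N p) / (z - p).

(** The remainder of [F 0] is divided by [z - p]. At [q = p] this costs one
    order, so the Taylor expansion of order four is needed there; elsewhere
    the coefficients are those of the division of the Taylor polynomial by
    [q - p + h] in increasing powers of [h]. *)
Lemma difference_quotient_expansion Y F p q (rho : R) : 0 < rho ->
  (forall z, normc (z - q) < rho -> Y z) -> derivative_tower Y F ->
  let g := difference_quotient F p in
  exists a1 a2 : R[i], exists K r : R, 0 < r /\ forall h, normc h < r ->
    normc (g (q + h) - (g q + a1 * h + a2 * h ^+ 2)) <= K * normc h ^+ 3.
Proof.
move=> rho0 qY FT g.
have f2 : (2`!%:R : R[i]) = 2 by [].
have f3 : (3`!%:R : R[i]) = 6 by [].
have n2 : (2 : R[i]) != 0 by rewrite pnatr_eq0.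
have n6 : (6 : R[i]) != 0 by rewrite pnatr_eq0.
have [qp|qp] := eqVneq q p.
  have [C [r [C0 r0 rF]]] := taylor_expansion 4 rho0 qY FT.
  exists (F 2%N q / 2), (F 3%N q / 6), C, r; split => // h hr.
  have [->|h0] := eqVneq h 0.
    have z2 : (0 : R[i]) ^+ 2 = 0 by rewrite expr0n.
    by rewrite z2 !mulr0 !addr0 subrr Normc.normc0 expr0n mulr0.
  have hn0 : 0 < normc h by rewrite normc_gt0.
  have -> : g (q + h) - (g q + F 2%N q / 2 * h + F 3%N q / 6 * h ^+ 2) =
      (F 0%N (q + h) - \sum_(j < 4) F j q / j`!%:R * h ^+ j) / h.
    rewrite /g /difference_quotient qp eqxx -[X in _ == X]addr0.
    rewrite (inj_eq (addrI p)) (negbTE h0) !big_ord_recl big_ord0 /bump /=.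
    rewrite f2 f3 !fact0 !expr0 !divr1 addr0.
    by field; rewrite h0.
  rewrite Normc.normcM Normc.normcV ler_pdivrMr// -mulrA -exprSr.
  exact: rF.
pose u := q - p.
have u0 : u != 0 by rewrite subr_eq0.
have nu : 0 < normc u by rewrite normc_gt0.
have [C [r [C0 r0 rF]]] := taylor_expansion 3 rho0 qY FT.
pose a1 := (F 1%N q - g q) / u; pose a2 := (F 2%N q / 2 - a1) / u.
exists a1, a2, ((C + normc a2) * (2 / normc u)), (Num.min r (normc u / 2)).
split => [|h]; first by rewrite lt_min r0 divr_gt0.
rewrite lt_min => /andP[hr hu].
have uh : normc u / 2 <= normc (u + h).
  have := normc_sub (u + h) h; rewrite addrK; lra.
have uh0 : u + h != 0 by rewrite -normc_gt0 (lt_le_trans _ uh)// divr_gt0.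
have gq : g q = (F 0%N q - F 0%N p) / u.
  by rewrite /g /difference_quotient (negbTE qp).
have gqh : g (q + h) = (F 0%N (q + h) - F 0%N p) / (u + h).
  rewrite /g /difference_quotient -subr_eq0 addrAC -/u (negbTE uh0).
  by rewrite /u addrAC.
have -> : g (q + h) - (g q + a1 * h + a2 * h ^+ 2) =
    (F 0%N (q + h) - \sum_(j < 3) F j q / j`!%:R * h ^+ j - a2 * h ^+ 3)
    / (u + h).
  rewrite !big_ord_recl big_ord0 /bump /= f2 !fact0 !expr0 !divr1 addr0 gqh.
  have FE : F 0%N q = g q * u + F 0%N p by rewrite gq divfK// subrK.
  have FE1 : F 1%N q = a1 * u + g q by rewrite /a1 divfK// subrK.
  have FE2 : F 2%N q / 2 = a2 * u + a1 by rewrite /a2 divfK// subrK.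
  rewrite FE2 FE1 FE; field; exact: uh0.
have h3 : 0 <= normc h ^+ 3 by rewrite exprn_ge0 ?normc_ge0.
rewrite Normc.normcM Normc.normcV [leRHS]mulrAC.
apply: ler_pM; rewrite ?normc_ge0 ?invr_ge0 ?normc_ge0//.
  rewrite (le_trans (normc_sub _ _))// [leRHS]mulrDl.
  apply: lerD; first exact: rF.
  by rewrite Normc.normcM normc_exp.
by rewrite -[leRHS]invrK lef_pV2 ?posrE ?normc_gt0// ?invr_gt0 ?divr_gt0// invf_div.
Qed.

Lemma difference_quotient_continuous Y F p q : derivative_tower Y F ->
  Y p -> Y q -> let g := difference_quotient F p in
  forall e : R, 0 < e -> exists2 r : R, 0 < r &
    forall w, Y w -> normc (w - q) < r -> normc (g w - g q) < e.
Proof.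
move=> FT Yp Yq g e e0; have e2 : 0 < e / 2 by rewrite divr_gt0.
have [->|qp] := eqVneq q p.
  have [r r0 rF] := FT 0%N p Yp _ e2.
  exists r => // w Yw wr; rewrite /g /difference_quotient eqxx.
  case: eqVneq => [_|wp]; first by rewrite subrr Normc.normc0.
  have wp0 : w - p != 0 by rewrite subr_eq0.
  have nwp : 0 < normc (w - p) by rewrite normc_gt0.
  rewrite (@le_lt_trans _ _ (e / 2))//; last by lra.
  rewrite -(ler_pM2r nwp) -Normc.normcM mulrBl divfK//.
  exact: rF.
pose u := q - p.
have u0 : u != 0 by rewrite subr_eq0.
have nu : 0 < normc u by rewrite normc_gt0.
have [r r0 rF] := has_cderiv_lipschitz (FT 0%N q Yq).
pose L := normc (F 1%N q) + 1 + normc (g q).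
have L0 : 0 < L by rewrite /L addrAC ltr_wpDl// addr_ge0 ?normc_ge0.
pose d := Num.min (normc u / 2) (e * (normc u / 2) / L).
exists (Num.min r d).
  by rewrite !lt_min r0 !divr_gt0 ?mulr_gt0// divr_gt0.
move=> w Yw; rewrite !lt_min => /andP[wr /andP[wu we]].
have wp : normc u / 2 <= normc (w - p).
  have := normc_dist_triangle w q p; rewrite (normc_distC q w) -/u; lra.
have wp0 : 0 < normc (w - p) by rewrite (lt_le_trans _ wp)// divr_gt0.
have wpE : w - p != 0 by rewrite -normc_gt0.
have -> : g w - g q = (F 0%N w - F 0%N q - g q * (w - q)) / (w - p).
  rewrite {1}/g /difference_quotient -subr_eq0 (negbTE wpE).
  have -> : F 0%N q = g q * u + F 0%N p.
    by rewrite /g /difference_quotient (negbTE qp) divfK// subrK.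
  by rewrite /u; field.
rewrite Normc.normcM Normc.normcV ltr_pdivrMr//.
rewrite (@lt_le_trans _ _ (e * (normc u / 2)))//; last by rewrite ler_pM2l.
rewrite (le_lt_trans (normc_sub _ _))//.
rewrite (@le_lt_trans _ _ (L * normc (w - q)))//.
  by rewrite /L mulrDl Normc.normcM lerD// rF.
by rewrite mulrC -ltr_pdivlMr.
Qed.

(** The maximum principle for the difference quotient, as in the lemma of
    Schwarz. *)
Lemma schwarz_estimate Y F p (s B : R) : compact Y -> derivative_tower Y F ->
  0 < s -> closed_disc p s `<=` Y -> (forall z, closed_disc p s z -> normc (F 0%N z) <= B) ->
  normc (F 1%N p) <= 2 * B / s /\
  forall z, closed_disc p s z -> normc (F 0%N z - F 0%N p) <= 2 * B / s * normc (z - p).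
Proof.
move=> Yc FT s0 sY FB; set g := difference_quotient F p.
have pp : closed_disc p s p by rewrite /closed_disc /= subrr Normc.normc0 ltW.
have discc : compact (closed_disc p s) by apply: subclosed_compact sY => //; exact: closed_disc_closed.
have gB z : closed_disc p s z -> normc (g z) <= 2 * B / s.
  apply: maximum_principle => // [q qs e e0|q qs|w wps].
  - have [r r0 rg] := difference_quotient_continuous FT (sY _ pp) (sY _ qs) e0.
    by exists r => // w /sY Yw wr; exact: rg.
  - have rho0 : 0 < s - normc (q - p) by rewrite subr_gt0.
    apply: (difference_quotient_expansion p rho0 _ FT) => w wq.
    apply: sY; rewrite /closed_disc /= (le_trans (normc_dist_triangle q _ _))//.
    by rewrite -lerBrDr ltW.
  - have wp0 : w - p != 0 by rewrite -normc_gt0 wps.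
    rewrite /g /difference_quotient -subr_eq0 (negbTE wp0).
    rewrite Normc.normcM Normc.normcV wps ler_pM2r ?invr_gt0//.
    rewrite (le_trans (normc_sub _ _))// mulr_natl mulr2n lerD ?FB//.
    by rewrite /closed_disc /= wps.
split=> [|z zs].
  by have := gB p pp; rewrite /g /difference_quotient eqxx.
have := gB z zs; rewrite /g /difference_quotient.
case: eqVneq => [-> _|zp gz]; first by rewrite !subrr Normc.normc0 mulr0.
have zp0 : z - p != 0 by rewrite subr_eq0.
by rewrite -[F 0%N z - _](divfK zp0) Normc.normcM ler_wpM2r ?normc_ge0.
Qed.

(** [k ^ k / k!] is at most the central binomial coefficient, hence at most
    [2 ^ (2 k)]. *)
Lemma expn_le_4expn_fact k : (k ^ k <= 4 ^ k * k`!)%N.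
Proof.
have ff : forall m n, (m ^ n <= (m + n) ^_ n)%N.
  move=> m; elim=> [|n IH]; first by rewrite expn0 ffactn0.
  by rewrite expnS addnS ffactnS leq_mul//= (leq_trans (leq_addr n m)).
rewrite (leq_trans (ff k k))// -bin_ffact leq_mul2r; apply/orP; right.
have -> : (4 ^ k = 2 ^ (k + k))%N by rewrite addnn -mul2n expnM.
rewrite -[(2 ^ _)%N]/((1 + 1) ^ _)%N expnDn (bigD1 (inord k)) //=.
by rewrite !exp1n !muln1 inordK ?ltnS ?leq_addr.
Qed.

(** Apply [schwarz_estimate] [k] times, each time on discs of radius [s / k]:
    every derivation costs a factor [2 k / s], and the resulting [k ^ k] is
    absorbed by [k!] up to a geometric factor. *)
Lemma cauchy_estimate Y F p (s B : R) k : compact Y -> derivative_tower Y F ->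
  0 < s -> closed_disc p s `<=` Y -> (forall z, closed_disc p s z -> normc (F 0%N z) <= B) ->
  normc (F k p) <= B * (8 / s) ^+ k * k`!%:R.
Proof.
move=> Yc FT s0 sY FB.
have pp : closed_disc p s p by rewrite /closed_disc /= subrr Normc.normc0 ltW.
have B0 : 0 <= B by rewrite (le_trans (normc_ge0 _) (FB p pp)).
case: k => [|k]; first by rewrite expr0 fact0 !mulr1 FB.
pose K : R := k.+1%:R.
have K0 : 0 < K by rewrite ltr0n.
have sK0 : 0 < s / K by rewrite divr_gt0.
have FJ j : (j <= k.+1)%N -> forall z, closed_disc p (s - j%:R * (s / K)) z ->
    normc (F j z) <= B * (2 * K / s) ^+ j.
  elim: j => [|j IH] jk z zj.
    by rewrite expr0 mulr1 FB//; move: zj; rewrite mul0r subr0.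
  have zz : closed_disc z (s / K) `<=` closed_disc p (s - j%:R * (s / K)).
    move=> w; rewrite /closed_disc /= => wz.
    rewrite (le_trans (normc_dist_triangle z _ _))//.
    move: wz zj; rewrite /closed_disc /= -[j.+1%:R]natr1 mulrDl mul1r.
    by set d := s / K; lra.
  have zY : closed_disc z (s / K) `<=` Y.
    move=> w /zz; rewrite /closed_disc /= => ws; apply: sY; rewrite /closed_disc /=.
    by rewrite (le_trans ws)// gerBl mulr_ge0 ?(ltW sK0).
  have [+ _] := schwarz_estimate Yc (tower_shift j FT) sK0 zY
    (fun w ws => IH (ltnW jk) w (zz w ws)).
  rewrite /= add1n => /le_trans; apply; rewrite exprSr le_eqVlt; apply/orP; left.
  by apply/eqP; field; rewrite !gt_eqF.
have := FJ k.+1 (leqnn _) p.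
rewrite mulrC divfK ?gt_eqF// subrr => /(_ _)/le_trans; apply.
  by rewrite /closed_disc /= subrr Normc.normc0.
rewrite -[leRHS]mulrA ler_wpM2l//.
have -> : 2 * K / s = (2 / s) * K by field; rewrite gt_eqF.
have -> : 8 / s = (2 / s) * 4 by field; rewrite gt_eqF.
have t0 : 0 <= 2 / s by rewrite divr_ge0 ?(ltW s0).
rewrite !(exprMn _ (2 / s)) -[leRHS]mulrA ler_wpM2l ?exprn_ge0//.
by rewrite /K -!natrX -natrM ler_nat expn_le_4expn_fact.
Qed.

End CauchyEstimates.


(** * Powers of formal power series *)

Section PowerCoefficients.
Implicit Types (A : comNzRingType) (k n : nat).

(** The coefficient of [T ^ n] in the [k]-th power of the formal power series
    with coefficients [a 1, a 2, ...] and no constant term. *)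
Fixpoint pcoef (A : comNzRingType) (a : nat -> A) k n : A :=
  if k is k'.+1 then \sum_(i < n) a i.+1 * pcoef a k' (n - i.+1)
  else (n == 0%N)%:R.

Lemma pcoef_small A (a : nat -> A) k n : (n < k)%N -> pcoef a k n = 0.
Proof.
elim: k n => [//|k IH] n nk /=; rewrite big1// => i _.
rewrite IH ?mulr0// (leq_trans _ (nk : (n <= k)%N))//.
by rewrite ltn_subrL (leq_ltn_trans _ (ltn_ord i)).
Qed.

Lemma pcoef_diag A (a : nat -> A) k : pcoef a k.+1 k.+1 = a 1%N * pcoef a k k.
Proof.
rewrite /= big_ord_recl subn1 /= big1 ?addr0// => i _.
by rewrite pcoef_small ?mulr0// /bump /= add1n subSS ltn_subrL (leq_ltn_trans _ (ltn_ord i)).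
Qed.

Lemma pcoef_ge0 (R : realType) (b : nat -> R) k n :
  (forall i, 0 <= b i) -> 0 <= pcoef b k n.
Proof.
move=> b0; elim: k n => [|k IH] n /=; first by rewrite ler0n.
by rewrite sumr_ge0// => i _; rewrite mulr_ge0.
Qed.

Lemma normc_pcoef (R : realType) (a : nat -> R[i]) (b : nat -> R) k n :
  (forall i, normc (a i) <= b i) -> normc (pcoef a k n) <= pcoef b k n.
Proof.
move=> ab; elim: k n => [|k IH] n /=; first by rewrite normc_nat.
rewrite (le_trans (normc_sum _ _ _))// ler_sum// => i _.
by rewrite Normc.normcM ler_pM ?normc_ge0.
Qed.

End PowerCoefficients.

(** * Weighted l1 norms and quasinilpotence *)

Section Majorant.
Context {R : realType}.
Implicit Types (w b : nat -> R) (e d S : R).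

Lemma sum_convolution w b N :
  \sum_(n < N) \sum_(i < n) w i * b (n - i.+1)%N =
  \sum_(i < N) w i * \sum_(m < N - i.+1) b m.
Proof.
elim: N => [|N IH]; first by rewrite !big_ord0.
rewrite big_ord_recr IH [RHS]big_ord_recr /= subnn big_ord0 mulr0 addr0.
rewrite -big_split /=; apply: eq_bigr => i _; rewrite -mulrDr; congr (_ * _).
by rewrite subSS -(subnSK (ltn_ord i)) big_ord_recr.
Qed.

(** The weighted l1 norm of power series is submultiplicative because the
    weight is. *)
Lemma weighted_pcoef_le w b e k N : (forall n, 0 <= w n) ->
  (forall m n, w (m + n)%N <= w m * w n) -> (forall i, 0 <= b i) -> 0 <= e ->
  (forall n, \sum_(i < n) w i.+1 * b i.+1 <= e) ->
  \sum_(n < N) w n * pcoef b k n <= w 0%N * e ^+ k.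
Proof.
move=> w0 wM b0 e0 we; elim: k N => [|k IH] N.
  case: N => [|N]; first by rewrite big_ord0 expr0 mulr1 w0.
  rewrite big_ord_recl /= big1 ?addr0 ?expr0// => i _.
  by rewrite mulr0.
pose f n := w n * pcoef b k n.
have f0 n : 0 <= f n by rewrite mulr_ge0// pcoef_ge0.
apply: (@le_trans _ _ (\sum_(n < N) \sum_(i < n) (w i.+1 * b i.+1) * f (n - i.+1)%N)).
  apply: ler_sum => n _; rewrite /= mulr_sumr; apply: ler_sum => i _.
  rewrite /f mulrACA; apply: ler_wpM2r; first by rewrite mulr_ge0// pcoef_ge0.
  by rewrite -{1}(subnKC (ltn_ord i)) wM.
rewrite (sum_convolution (fun i => w i.+1 * b i.+1)) exprS mulrCA.
apply: (@le_trans _ _ (\sum_(i < N) (w i.+1 * b i.+1) * (w 0%N * e ^+ k))).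
  by apply: ler_sum => i _; rewrite ler_wpM2l ?mulr_ge0// IH.
by rewrite -mulr_suml ler_wpM2r// mulr_ge0// exprn_ge0.
Qed.

Definition exponentially_small w :=
  forall d, 0 < d -> exists C, forall n, w n <= C * d ^+ n.

(** The weight [w'] is the largest submultiplicative minorant of [w] and of
    the geometric weight of ratio [d]; a radical weight is equivalent to it. *)
Lemma geometric_minorant_weight w d : (forall n, 0 <= w n) -> w 0%N = 1 ->
  (forall m n, w (m + n)%N <= w m * w n) -> exponentially_small w -> 0 < d ->
  exists w' : nat -> R, [/\ forall n, 0 <= w' n,
    forall m n, w' (m + n)%N <= w' m * w' n, forall n, w' n <= d ^+ n,
    forall n, w' n <= w n & exists2 C, 0 <= C & forall n, w n <= C * w' n].
Proof.
move=> w0 w1 wM wsmall d0.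
have step n : exists2 s, (s <= n)%N &
    forall t, (t <= n)%N -> d ^+ s * w (n - s)%N <= d ^+ t * w (n - t)%N.
  case: (@arg_minP _ _ _ (ord0 : 'I_n.+1) predT
    (fun s : 'I_n.+1 => d ^+ s * w (n - s)%N) isT) => s _ smin.
  exists (s : nat); first by rewrite -ltnS.
  by move=> t tn; have := smin (inord t) isT; rewrite inordK.
pose s n := sval (cid2 (step n)).
have sn n : (s n <= n)%N by rewrite /s; case: cid2.
have smin n t : (t <= n)%N -> d ^+ s n * w (n - s n)%N <= d ^+ t * w (n - t)%N.
  by rewrite /s; case: cid2 => s' ? h /h.
exists (fun n => d ^+ s n * w (n - s n)%N); split.
- by move=> n; rewrite mulr_ge0// exprn_ge0// ltW.
- move=> m n; rewrite mulrACA -exprD.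
  rewrite (le_trans (smin _ _ (leq_add (sn m) (sn n))))//.
  rewrite ler_wpM2l ?exprn_ge0 ?(ltW d0)//.
  have -> : (m + n - (s m + s n) = (m - s m) + (n - s n))%N.
    by rewrite subnDA -addnBAC// -addnBA.
  exact: wM.
- by move=> n; have := smin n n (leqnn n); rewrite subnn w1 mulr1.
- by move=> n; have := smin n 0%N (leq0n n); rewrite expr0 mul1r subn0.
- have [C wC] := wsmall d d0.
  have C0 : 0 <= C by have := wC 0%N; rewrite w1 expr0 mulr1; exact: le_trans.
  exists C => // n; rewrite mulrA -{1}(subnKC (sn n)).
  by rewrite (le_trans (wM _ _))// ler_wpM2r.
Qed.

Lemma sum_truncate_le (u : nat -> R) n L : (forall i, 0 <= u i) ->
  \sum_(i < n | (i < L)%N) u i <= \sum_(i < L) u i.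
Proof.
move=> u0; have [nL|Ln] := leqP n L.
  rewrite (big_ord_widen_cond L (fun i => (i < L)%N) u nL) big_mkcond /=.
  by apply: ler_sum => i _; case: ifP.
by rewrite -(big_ord_widen n u (ltnW Ln)).
Qed.

Lemma small_tail (u : nat -> R) S e : (forall n, 0 <= u n) ->
  (forall n, \sum_(i < n) u i <= S) -> 0 < e ->
  exists L, forall n, \sum_(i < n | (L <= i)%N) u i <= e.
Proof.
move=> u0 uS e0; pose A := range (fun n => \sum_(i < n) u i).
have supA : has_sup A.
  split; first by exists (\sum_(i < 0) u i), 0%N.
  by exists S => _ [n _ <-].
have [_ [L _ <-] Lsup] := sup_adherent e0 supA.
exists L => n; have [nL|Ln] := leqP n L.
  rewrite big1 ?ltW// => i Li.
  by have := leq_trans (ltn_ord i) (leq_trans nL Li); rewrite ltnn.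
have : \sum_(i < n) u i <= sup A by apply: ub_le_sup; [case: supA|exists n].
rewrite (bigID (fun i : 'I_n => (i < L)%N)) /=.
rewrite -(big_ord_widen n u (ltnW Ln)).
under [X in _ + X <= _]eq_bigl do rewrite -leqNgt.
move: Lsup; set a := bigop _ _ _; lra.
Qed.

(** A series without constant term is quasinilpotent: the weight being
    radical, it may be replaced by an equivalent one for which the series has
    norm at most [e]. *)
Lemma weighted_pcoef_decay w b S e : (forall n, 0 <= w n) -> w 0%N = 1 ->
  (forall m n, w (m + n)%N <= w m * w n) -> exponentially_small w ->
  (forall i, 0 <= b i) -> (forall n, \sum_(i < n) w i.+1 * b i.+1 <= S) ->
  0 < e -> exists2 C, 0 <= C &
    forall k N, \sum_(n < N) w n * pcoef b k n <= C * e ^+ k.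
Proof.
move=> w0 w1 wM wsmall b0 wS e0; have e2 : 0 < e / 2 by rewrite divr_gt0.
have [L tailL] := small_tail (fun i => mulr_ge0 (w0 i.+1) (b0 i.+1)) wS e2.
pose B := \sum_(i < L) b i.+1.
have B0 : 0 <= B by rewrite sumr_ge0.
(* The first [L] terms are made small by the geometric weight, the other ones
   by the tail of the series for [w]; [w'] lies below both weights. *)
pose d := Num.min 1 (e / (2 * (B + 1))).
have d0 : 0 < d by rewrite lt_min ltr01 divr_gt0// mulr_gt0// ltr_wpDl.
have dB : d * B <= e / 2.
  rewrite (@le_trans _ _ (e / (2 * (B + 1)) * B))//.
    by rewrite ler_wpM2r// ge_min lexx orbT.
  rewrite invfM mulrA -mulrA ler_piMr ?(ltW e2)// ler_pdivrMl; lra.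
have [w' [w'0 w'M w'd w'w [C C0 wC]]] := geometric_minorant_weight w0 w1 wM wsmall d0.
have w'e n : \sum_(i < n) w' i.+1 * b i.+1 <= e.
  rewrite (bigID (fun i : 'I_n => (i < L)%N)) /= (splitr e) lerD//.
    rewrite (le_trans _ dB)// /B mulr_sumr.
    rewrite (le_trans _ (@sum_truncate_le (fun i => d * b i.+1) n L _))//.
      apply: ler_sum => i _.
      rewrite ler_wpM2r// (le_trans (w'd _))// exprS ler_piMr ?(ltW d0)//.
      by rewrite exprn_ile1 ?(ltW d0)// ge_min lexx.
    by move=> i; rewrite mulr_ge0// ltW.
  rewrite (le_trans _ (tailL n))//.
  under eq_bigl do rewrite -leqNgt.
  by apply: ler_sum => i _; rewrite ler_wpM2r.
exists (C * w' 0%N) => [|k N]; first by rewrite mulr_ge0.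
rewrite -mulrA (le_trans _ (ler_wpM2l C0 (weighted_pcoef_le k N w'0 w'M b0 (ltW e0) w'e)))//.
rewrite mulr_sumr ler_sum// => n _.
by rewrite mulrA ler_wpM2r// pcoef_ge0.
Qed.

End Majorant.

(** * The formula of Faa di Bruno *)

Section ChainRule.
Context {R : realType}.
Implicit Types (X Y : set R[i]) (F Phi : nat -> R[i] -> R[i]).

(** The power coefficients of the Taylor series of [Phi 0] at [x], without
    its constant term. *)
Definition taylor_pcoef Phi k n (x : R[i]) : R[i] :=
  pcoef (fun i => Phi i x / i`!%:R) k n.

Let factC_neq0 n : (n`!%:R : R[i]) != 0.
Proof. by rewrite pnatr_eq0 -lt0n fact_gt0. Qed.

(** With [P] the Taylor series of [Phi 0] at [x] minus its constant term, this
    is the coefficient form of [d/dx P^k = k P^(k-1) (d/dT P - Phi 1 x)]. *)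
Lemma taylor_pcoef_deriv X Phi k n x : derivative_tower X Phi -> X x ->
  has_cderiv X (taylor_pcoef Phi k n) x
   (n.+1%:R * taylor_pcoef Phi k n.+1 x
    - k%:R * Phi 1%N x * taylor_pcoef Phi k.-1 n x).
Proof.
move=> PT Xx; pose a i y := Phi i y / i`!%:R.
elim: k n => [|k IH] n.
  by rewrite /taylor_pcoef /= mulr0 !mul0r subr0; exact: has_cderiv_cst.
pose P := taylor_pcoef Phi.
have aD i : has_cderiv X (a i) x (i.+1%:R * a i.+1 x).
  have -> : i.+1%:R * a i.+1 x = (i`!%:R)^-1 * Phi i.+1 x.
    rewrite /a factS natrM; field.
    by rewrite factC_neq0 addrC natr1 pnatr_eq0.
  have -> : a i = fun y => (i`!%:R)^-1 * Phi i y.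
    by apply/funext => y; rewrite /a mulrC.
  exact/has_cderivZ/PT.
pose D i := i.+2%:R * a i.+2 x * P k (n - i.+1)%N x + a i.+1 x *
  ((n - i.+1).+1%:R * P k (n - i.+1).+1 x - k%:R * Phi 1%N x * P k.-1 (n - i.+1)%N x).
have -> : n.+1%:R * taylor_pcoef Phi k.+1 n.+1 x
    - k.+1%:R * Phi 1%N x * taylor_pcoef Phi k.+1.-1 n x = \sum_(i < n) D i.
  have PS j m : P j.+1 m x = \sum_(i < m) a i.+1 x * P j (m - i.+1)%N x by [].
  have S1 : \sum_(i < n) i.+2%:R * a i.+2 x * P k (n - i.+1)%N x =
      \sum_(i < n.+1) i.+1%:R * a i.+1 x * P k (n - i)%N x - a 1%N x * P k n x.
    by rewrite big_ord_recl /= subn0 mul1r addrAC subrr add0r.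
  have S2 : \sum_(i < n) a i.+1 x * ((n - i.+1).+1%:R * P k (n - i.+1).+1 x) =
      \sum_(i < n.+1) (n - i)%:R * a i.+1 x * P k (n - i)%N x.
    rewrite big_ord_recr /= subnn mul0r mul0r addr0; apply: eq_bigr => i _.
    by rewrite subnSK// mulrCA mulrA.
  have S3 : \sum_(i < n) a i.+1 x * (k%:R * Phi 1%N x * P k.-1 (n - i.+1)%N x) =
      k%:R * Phi 1%N x * P k n x.
    case: k {IH D S1 S2} => [|k].
      by rewrite !mul0r big1// => i _; rewrite !mul0r mulr0.
    rewrite PS mulr_sumr.
    by apply: eq_bigr => i _; rewrite mulrCA.
  have a1 : a 1%N x = Phi 1%N x by rewrite /a divr1.
  under eq_bigr do rewrite /D mulrBr.
  rewrite big_split /= sumrB S1 S2 S3 -/P PS mulr_sumr /=.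
  have -> : \sum_(i < n.+1) n.+1%:R * (a i.+1 x * P k (n.+1 - i.+1)%N x) =
      \sum_(i < n.+1) i.+1%:R * a i.+1 x * P k (n - i)%N x
      + \sum_(i < n.+1) (n - i)%:R * a i.+1 x * P k (n - i)%N x.
    rewrite -big_split /=; apply: eq_bigr => i _.
    rewrite subSS -!mulrA -mulrDl -natrD addSn subnKC//.
    by rewrite -ltnS.
  by rewrite a1 -[k.+1%:R]natr1; ring.
apply: (has_cderiv_sum (F := fun i y => a i.+1 y * P k (n - i.+1)%N y) (D := D)).
by move=> i _; apply: has_cderivM; [exact: aD|exact: IH].
Qed.

(** The formula of Faa di Bruno: the [n]-th term collects the coefficient of
    [T ^ n] in the composition of the two Taylor series. *)
Definition compose_tower F Phi n (x : R[i]) : R[i] :=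
  n`!%:R * \sum_(k < n.+1) F k (Phi 0%N x) / k`!%:R * taylor_pcoef Phi k n x.

Lemma compose_tower0 F Phi x : compose_tower F Phi 0 x = F 0%N (Phi 0%N x).
Proof.
rewrite /compose_tower fact0 mul1r big_ord_recl big_ord0 addr0 fact0 divr1.
by rewrite /taylor_pcoef /= mulr1.
Qed.

(** Differentiating the sum term by term, the derivative of [F k] in the
    [k]-th term cancels against the correction term of [taylor_pcoef_deriv] in
    the next one; only the term [k = n] remains, which completes the sum of
    order [n + 1]. *)
Lemma compose_towerP X Y F Phi : derivative_tower X Phi ->
  derivative_tower Y F -> (forall x, X x -> Y (Phi 0%N x)) ->
  derivative_tower X (compose_tower F Phi).
Proof.
move=> PT FT XY n x Xx; pose P := taylor_pcoef Phi; pose y := Phi 0%N x.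
pose u k := F k.+1 y / k`!%:R * P k n x * Phi 1%N x.
pose v k := F k y / k`!%:R * (k%:R * Phi 1%N x * P k.-1 n x).
pose D k := F k.+1 y * Phi 1%N x / k`!%:R * P k n x + F k y / k`!%:R *
  (n.+1%:R * P k n.+1 x - k%:R * Phi 1%N x * P k.-1 n x).
have vS k : v k.+1 = u k.
  rewrite /v /u factS natrM; field.
  by rewrite factC_neq0 addrC natr1 pnatr_eq0.
have -> : compose_tower F Phi n.+1 x = n`!%:R * \sum_(k < n.+1) D k.
  have DE k : D k = n.+1%:R * (F k y / k`!%:R * P k n.+1 x) + (u k - v k).
    by rewrite /D /u /v; ring.
  under [X in _ = _ * X]eq_bigr do rewrite DE.
  rewrite big_split sumrB /= [X in _ + (X - _)]big_ord_recr /=.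
  rewrite [X in _ + (_ - X)]big_ord_recl /=.
  have -> : v 0%N = 0 by rewrite /v !mul0r mulr0.
  rewrite add0r; under [X in _ + (_ - X)]eq_bigr do rewrite /bump /= add1n vS.
  rewrite [_ + u n]addrC addrK /compose_tower big_ord_recr /= -/y.
  rewrite [taylor_pcoef Phi n.+1 n.+1 x]pcoef_diag -mulr_sumr.
  rewrite factS natrM -/P /u divr1.
  set s := \sum_(k < n.+1) _; rewrite /P /taylor_pcoef; field.
  by rewrite factC_neq0 addrC natr1 pnatr_eq0.
apply: has_cderivZ.
apply: (has_cderiv_sum (F := fun k z => F k (Phi 0%N z) / k`!%:R * P k n z) (D := D)).
move=> k _; apply: has_cderivM; last exact: taylor_pcoef_deriv.
have -> : (fun z => F k (Phi 0%N z) / k`!%:R) = (fun z => (k`!%:R)^-1 * F k (Phi 0%N z)).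
  by apply/funext => z; rewrite mulrC.
rewrite [_ / k`!%:R]mulrC; apply: has_cderivZ.
by apply: has_cderiv_comp (XY) _ _; [exact: PT|exact/FT/XY].
Qed.

End ChainRule.


(** * Uniformity on compact sets *)

Section Compactness.
Context {R : realType}.
Implicit Types (X Y : set R[i]).

(** The form in which compactness is used: to bound continuous functions, to
    keep a positive distance from a closed set, and to make Cauchy properties
    uniform. *)
Lemma compact_uniformly X (I : Type) (F : set_system I) (P : I -> R[i] -> Prop) :
  compact X -> Filter F ->
  (forall x, X x -> exists2 r : R, 0 < r & exists2 A, F A &
     forall x' i, X x' -> normc (x' - x) < r -> A i -> P i x') ->
  \forall i \near F, forall x, X x -> P i x.
Proof.
move=> Xc FF XP.
have := iffRL (near_covering_withinP X) (iffLR (compact_near_coveringP X) Xc).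
apply=> x Xx; have [r r0 [A FA AP]] := XP x Xx.
exists ([set x' | normc (x' - x) < r], A).
  by split=> //=; apply/nbhs_normcP; exists r.
by move=> [x' i] [/= xr Ai] Xx'; exact: AP.
Qed.

Lemma tower_bounded X (F : nat -> R[i] -> R[i]) n : compact X ->
  derivative_tower X F -> exists C : R, forall x, X x -> normc (F n x) <= C.
Proof.
move=> Xc FT; have := @compact_uniformly X R (pinfty_nbhs R)
  (fun C x => normc (F n x) <= C) Xc _.
case/(_ _)/(_ _)/filter_ex => [x Xx|C]; last by exists C.
have [r r0 rF] := has_cderiv_continuous (FT n x Xx) ltr01.
exists r => //; exists [set C | normc (F n x) + 1 <= C]; first by apply: nbhs_pinfty_ge; exact: num_real.
move=> x' C Xx' xr; apply: le_trans.
rewrite -[F n x'](subrK (F n x)) (le_trans (normc_triangle _ _))// addrC.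
by rewrite lerD2l ltW// rF.
Qed.

Lemma uniform_closed_disc X Y (phi : R[i] -> R[i]) : compact X ->
  (forall x, X x -> forall e : R, 0 < e -> exists2 r : R, 0 < r &
    forall z, X z -> normc (z - x) < r -> normc (phi z - phi x) < e) ->
  phi @` X `<=` Y° ->
  exists2 s : R, 0 < s & forall x, X x -> closed_disc (phi x) s `<=` Y.
Proof.
move=> Xc phic XY; have := @compact_uniformly X R (0 : R)^'+
  (fun s x => 0 < s /\ closed_disc (phi x) s `<=` Y) Xc _.
case/(_ _)/(_ _)/(@filter_ex _ _ (at_right_proper_filter (0 : R))) => [x Xx|s sP].
  have /nbhs_normcP[d d0 dY] : nbhs (phi x) Y by apply: XY; exists x.
  have d2 : 0 < d / 2 by rewrite divr_gt0.
  have [r r0 rphi] := phic x Xx _ d2.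
  exists r => //; exists [set s | 0 < s /\ s < d / 2].
    by apply: filterI; [exact: nbhs_right_gt | exact: nbhs_right_lt].
  move=> x' s Xx' xr [s0 sd]; split=> // z; rewrite /closed_disc /= => zs.
  apply: dY; rewrite (le_lt_trans (normc_dist_triangle (phi x') _ _))//.
  by have := rphi _ Xx' xr; lra.
have [[x Xx]|X0] := pselect (X !=set0).
  by exists s; [case: (sP x Xx) | move=> y Xy; case: (sP y Xy)].
by exists 1 => // x Xx; case: X0; exists x.
Qed.

End Compactness.

(** * Cauchy sequences along an ultrafilter *)

Section Ultrafilters.
Context {R : realType}.
Variables (U : set_system nat) (UU : UltraFilter U).

(** Passing to an ultrafilter makes all bounded numerical sequences Cauchy at
    once, so that no diagonal extraction of subsequences is required. *)
Lemma ultra_cauchy (v : nat -> R) (B : R) : (forall n, `|v n| <= B) ->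
  forall e, 0 < e -> exists2 A, U A & forall n m, A n -> A m -> `|v n - v m| < e.
Proof.
move=> vB e e0.
have UvB : (v @ U) `[- B, B]%classic.
  apply: (@filterS _ U _ setT); last exact: filterT.
  move=> n _; rewrite /= in_itv /=.
  by have := vB n; rewrite ler_norml.
have [x [_ clx]] := segment_compact _ UvB.
have e2 : 0 < e / 2 by rewrite divr_gt0.
exists (v @^-1` ball x (e / 2)).
  case: (in_ultra_setVsetC (v @^-1` ball x (e / 2)) UU) => // Uc.
  have [y [yc yx]] : (~` ball x (e / 2)) `&` ball x (e / 2) !=set0.
    by apply: clx; [exact: Uc | exact: nbhsx_ballx].
  by [].
move=> n m; rewrite -!ball_normE /= => xn xm; rewrite (splitr e).
by rewrite (le_lt_trans (ler_distD x _ _))// ltrD// distrC.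
Qed.

Lemma normc_le_Re_Im (z : R[i]) : normc z <= `|Re z| + `|complex.Im z|.
Proof.
have -> : z = (Re z)%:C + 'i * (complex.Im z)%:C by rewrite -complexE; case: z.
rewrite (le_trans (normc_triangle _ _))// Normc.normcM !normc_real.
by rewrite /= !(mul0r, mul1r, mulr0, subr0, addr0, add0r, expr0n, expr1n) /=
  ?(addr0, add0r) sqrtr1 mul1r.
Qed.

Lemma ultra_cauchyC (v : nat -> R[i]) (B : R) : (forall n, normc (v n) <= B) ->
  forall e : R, 0 < e ->
  exists2 A, U A & forall n m, A n -> A m -> normc (v n - v m) < e.
Proof.
move=> vB e e0; have e2 : 0 < e / 2 by rewrite divr_gt0.
have ReB n : `|Re (v n)| <= B.
  rewrite (le_trans _ (vB n))// ler_norml Re_le_normc andbT.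
  exact: Re_ge_normc.
have ImB n : `|complex.Im (v n)| <= B.
  rewrite (le_trans _ (vB n))//; case: (v n) => a b /=.
  by rewrite -sqrtr_sqr ler_wsqrtr// lerDr sqr_ge0.
have [A UA AP] := ultra_cauchy ReB e2; have [A' UA' AP'] := ultra_cauchy ImB e2.
exists (A `&` A'); first exact: filterI.
move=> n m [An A'n] [Am A'm]; rewrite (le_lt_trans (normc_le_Re_Im _))//.
by rewrite !raddfB /= (splitr e) ltrD ?AP ?AP'.
Qed.

(** The [j]-th term is picked in the intersection of the first [j + 1] of a
    sequence of sets of [U] whose diameters tend to zero; that intersection is
    in [U], hence infinite. *)
Lemma cauchy_subsequence (d : nat -> nat -> \bar R) : \oo `<=` U ->
  (forall e : R, 0 < e -> exists2 A, U A &
     forall n m, A n -> A m -> (d n m < e%:E)%E) ->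
  exists2 s : nat -> nat, {homo s : i j / (i < j)%N} &
    forall e : R, 0 < e -> exists N, forall m n, (N <= m)%N -> (N <= n)%N ->
      (d (s m) (s n) < e%:E)%E.
Proof.
move=> ooU dU.
have pos j : 0 < (j.+1%:R : R)^-1 by rewrite invr_gt0.
pose A j := sval (cid2 (dU _ (pos j))).
have UA j : U (A j) by rewrite /A; case: cid2.
have AP j n m : A j n -> A j m -> (d n m < (j.+1%:R^-1)%:E)%E.
  by rewrite /A; case: cid2 => A' ? h; exact: h.
pose B j := [set n | forall i, (i <= j)%N -> A i n].
have UB j : U (B j).
  elim: j => [|j IH].
    by apply: filterS (UA 0%N) => n An i; rewrite leqn0 => /eqP ->.
  apply: filterS (filterI IH (UA j.+1)) => n [Bn An] i.
  by rewrite leq_eqVlt => /orP[/eqP ->//|]; exact: Bn.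
have next j N : exists2 n, (N < n)%N & B j n.
  have : U (B j `&` [set n | (N < n)%N]).
    by apply: filterI => //; apply: ooU; exact: nbhs_infty_gt.
  by case/filter_ex => n [Bn Nn]; exists n.
pose nxt j N := sval (cid2 (next j N)).
have nxtN j N : (N < nxt j N)%N by rewrite /nxt; case: cid2.
have nxtB j N : B j (nxt j N) by rewrite /nxt; case: cid2.
pose s := fix s j := if j is j'.+1 then nxt j (s j') else nxt 0%N 0%N.
have sB j : B j (s j) by case: j => [|j]; exact: nxtB.
exists s; first by apply: homo_ltn => // [? ? ?|j]; [exact: ltn_trans|exact: nxtN].
move=> e e0; exists (Num.truncn e^-1) => m n Nm Nn.
apply: (@lt_trans _ _ (((Num.truncn e^-1).+1%:R)^-1)%:E).
  by apply: (AP (Num.truncn e^-1)); apply: sB.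
rewrite lte_fin invf_plt ?posrE//.
by rewrite real_truncnS_gt ?num_real.
Qed.

End Ultrafilters.

(** * Supremum norms and Dales-Davie norms *)

Section Norms.
Context {R : realType}.
Implicit Types (X : set R[i]) (f : R[i] -> R[i]) (M : nat -> R) (C : R).

Lemma normc_le_supnorm X f C x : (forall z, X z -> normc (f z) <= C) -> X x ->
  normc (f x) <= supnorm X f.
Proof.
move=> fC Xx; apply: ub_le_sup; last by exists x.
by exists C => _ [z Xz <-]; exact: fC.
Qed.

Lemma supnorm_le X f C : 0 <= C -> (forall z, X z -> normc (f z) <= C) ->
  supnorm X f <= C.
Proof.
move=> C0 fC; rewrite /supnorm; have [[x Xx]|X0] := pselect (X !=set0).
  by apply: ge_sup; [exists (normc (f x)), x | move=> _ [z Xz <-]; exact: fC].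
suff -> : [set normc (f z) | z in X] = set0 by rewrite sup0.
by rewrite -subset0 => y [z Xz _]; apply: X0; exists z.
Qed.

Lemma supnorm_ge0 X f : 0 <= supnorm X f.
Proof.
rewrite /supnorm; set A := image _ _.
have [supA|/sup_out->//] := pselect (has_sup A).
have [[y [x Xx _]] ubA] := supA.
by rewrite (le_trans (normc_ge0 (f x)))// ub_le_sup//; exists x.
Qed.

Lemma dnorm_le X M f C : (forall n, 0 < M n) ->
  (forall N, \sum_(n < N) supnorm X (cderivn X n f) / M n <= C) ->
  (dnorm X M f <= C%:E)%E.
Proof.
move=> M0 fC; apply: lime_le.
  by apply: is_cvg_nneseries => n _ _; rewrite lee_fin divr_ge0 ?supnorm_ge0// ltW.
by apply: nearW => N; rewrite sumEFin big_mkord lee_fin.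
Qed.

Lemma dnorm_ge X M f N : (forall n, 0 < M n) ->
  ((\sum_(n < N) supnorm X (cderivn X n f) / M n)%:E <= dnorm X M f)%E.
Proof.
move=> M0; rewrite -(big_mkord xpredT (fun n => supnorm X (cderivn X n f) / M n)).
rewrite -sumEFin; apply: nneseries_lim_ge => n _ _.
by rewrite lee_fin divr_ge0 ?supnorm_ge0// ltW.
Qed.

Lemma dnorm_partial_sums X M f : (forall n, 0 < M n) -> (dnorm X M f < +oo)%E ->
  exists S, forall N, \sum_(n < N) supnorm X (cderivn X n f) / M n <= S.
Proof.
move=> M0 fo; have ge N := dnorm_ge X f N M0.
exists (fine (dnorm X M f)) => N; rewrite -lee_fin fineK// fin_numE.
apply/andP; split; last by rewrite lt_eqF.
by rewrite gt_eqF// (lt_le_trans _ (ge 0%N))// ltNyr.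
Qed.

Lemma normc_cderivn_le X M f C n x : compact X -> (forall n, 0 < M n) ->
  infinitely_differentiable X f -> (dnorm X M f <= C%:E)%E -> X x ->
  normc (cderivn X n f x) <= C * M n.
Proof.
move=> Xc M0 fX fC Xx.
have [K fK] := tower_bounded n Xc (cderivn_tower fX).
rewrite (le_trans (normc_le_supnorm fK Xx))// -ler_pdivrMr//.
rewrite -lee_fin (le_trans _ fC)// (le_trans _ (dnorm_ge X f n.+1 M0))//.
rewrite lee_fin big_ord_recr /= lerDr sumr_ge0// => i _.
by rewrite divr_ge0 ?supnorm_ge0// ltW.
Qed.

End Norms.

(** * The weight attached to a weight sequence *)

Section Weights.
Context {R : realType}.
Variables (M : nat -> R) (M_weight : weight_sequence M).

(** With this weight, the weighted l1 norm of the series of the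
    [|f^(n)| / n!] is the norm of [f]. *)
Definition fact_weight (n : nat) : R := n`!%:R / M n.

Lemma weight_gt0 n : 0 < M n.
Proof. by case: M_weight. Qed.

Lemma fact_weight_gt0 n : 0 < fact_weight n.
Proof. by rewrite divr_gt0 ?weight_gt0// ltr0n fact_gt0. Qed.

Lemma fact_weight0 : fact_weight 0 = 1.
Proof. by rewrite /fact_weight fact0; case: M_weight => _ -> _; rewrite divr1. Qed.

Lemma fact_weightM m n : fact_weight (m + n) <= fact_weight m * fact_weight n.
Proof.
have [M0 _ /(_ n m) binM] := M_weight.
rewrite /fact_weight mulrACA -invfM ler_pdivrMr//.
have <- : ('C(m + n, m) * (m`! * n`!))%N = (m + n)`!.
  by rewrite -(bin_fact (leq_addr n m)) addKn.
rewrite natrM [leRHS](_ : _ = M (m + n)%N / (M m * M n) * (m`! * n`!)%:R).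
  by rewrite ler_wpM2r.
by rewrite natrM; ring.
Qed.

Lemma fact_weight_small : non_analytic M -> exponentially_small fact_weight.
Proof.
move=> Mna d d0.
have : \forall n \near \oo, fact_weight n <= d ^+ n.
  have : \forall n \near \oo, (fact_weight n) `^ (n%:R^-1) < d.
    by move/cvgrPdist_lt : Mna => /(_ d d0); apply: filterS => n;
      rewrite sub0r normrN ger0_norm// powR_ge0.
  move=> H; near=> n.
  have n0 : (0 < n)%N by near: n; exact: nbhs_infty_gt.
  have : (fact_weight n) `^ (n%:R^-1) < d by near: n.
  move=> /ltW h; have wn := ltW (fact_weight_gt0 n).
  have -> : fact_weight n = ((fact_weight n) `^ (n%:R^-1)) ^+ n.
    by rewrite -powR_mulrn ?powR_ge0// -powRrM mulVf ?powRr1// pnatr_eq0 -lt0n.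
  by rewrite lerXn2r ?nnegrE ?powR_ge0// ltW.
move=> [N _ NP]; exists (1 + \sum_(i < N) fact_weight i / d ^+ i) => n.
have u0 i : 0 <= fact_weight i / d ^+ i.
  by rewrite divr_ge0 ?exprn_ge0 ?(ltW d0)// ltW// fact_weight_gt0.
have dn : 0 < d ^+ n by rewrite exprn_gt0.
have [Nn|nN] := leqP N n.
  rewrite (le_trans (NP n Nn))// ler_peMl ?(ltW dn)// lerDl.
  by rewrite sumr_ge0.
rewrite -ler_pdivrMr// (bigD1 (Ordinal nN)) //= addrCA lerDl.
by rewrite addr_ge0// sumr_ge0.
Unshelve. all: by end_near. Qed.

End Weights.


(** * Composition with [phi] *)

Section Composition.
Context {R : realType}.
Variables (X Y : set R[i]) (M : nat -> R) (phi : R[i] -> R[i]).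
Hypotheses (X_compact : compact X) (X_perfect : perfect_set X).
Hypotheses (Y_compact : compact Y) (Y_perfect : perfect_set Y).
Hypotheses (M_weight : weight_sequence M) (M_na : non_analytic M).
Hypotheses (phi_D : Dalg X M phi) (phi_int : phi @` X `<=` Y°).

Let M0 := weight_gt0 M_weight.

Let phi_tower : derivative_tower X (fun n => cderivn X n phi).
Proof. by apply: cderivn_tower; case: phi_D. Qed.

Let phiY x : X x -> Y (phi x).
Proof. by move=> Xx; apply: (nbhs_singleton (phi_int _)); exists x. Qed.

Lemma perfect_limit_point (Z : set R[i]) : perfect_set Z -> Z `<=` limit_point Z.
Proof. by case=> _ ->. Qed.

Let jet_norm i : R := supnorm X (cderivn X i phi) / i`!%:R.

Let jet_norm_ge0 i : 0 <= jet_norm i.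
Proof. by rewrite divr_ge0 ?supnorm_ge0. Qed.

Let majorant k N : R := \sum_(n < N) fact_weight M n * pcoef jet_norm k n.

Let majorant_decay (e : R) : 0 < e ->
  exists2 C, 0 <= C & forall k N, majorant k N <= C * e ^+ k.
Proof.
move=> e0; have [S phiS] := dnorm_partial_sums M0 (proj2 phi_D).
apply: (@weighted_pcoef_decay _ _ _ S) => //.
- by move=> n; rewrite ltW// fact_weight_gt0.
- exact: fact_weight0.
- exact: fact_weightM.
- exact: fact_weight_small.
move=> n; rewrite (le_trans _ (phiS n.+1))// big_ord_recl /=.
rewrite (@le_trans _ _ (\sum_(i < n) supnorm X (cderivn X i.+1 phi) / M i.+1))//.
  apply: ler_sum => i _; rewrite /fact_weight /jet_norm.
  rewrite le_eqVlt; apply/orP; left; apply/eqP; field.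
  by rewrite gt_eqF// pnatr_eq0 -lt0n fact_gt0.
by rewrite lerDr divr_ge0 ?supnorm_ge0// ltW.
Qed.

(** The estimate behind the theorem: in the norm of the composition, the
    [k]-th Taylor coefficient of [f] is weighted by the norm of the [k]-th
    power of the majorant series of [phi]. *)
Let compose_norm f (a : nat -> R) N : infinitely_differentiable Y f ->
  (forall k x, X x -> normc (cderivn Y k f (phi x)) <= a k * k`!%:R) ->
  (forall k, 0 <= a k) ->
  infinitely_differentiable X (f \o phi) /\
  \sum_(n < N) supnorm X (cderivn X n (f \o phi)) / M n
    <= \sum_(k < N) a k * majorant k N.
Proof.
move=> fY fa a0; pose F k := cderivn Y k f; pose Phi n := cderivn X n phi.
have E_tower := compose_towerP phi_tower (cderivn_tower fY) phiY.
have E0 : eq_on X (f \o phi) (compose_tower F Phi 0).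
  by move=> x Xx; rewrite compose_tower0.
have [fphi EE] := tower_cderivn (perfect_limit_point X_perfect) E_tower E0.
split=> //.
have bound n x : X x -> normc (cderivn X n (f \o phi) x) <=
    n`!%:R * \sum_(k < n.+1) a k * pcoef jet_norm k n.
  move=> Xx; rewrite EE// /compose_tower Normc.normcM normc_nat ler_wpM2l//.
  rewrite (le_trans (normc_sum _ _ _))// ler_sum// => k _.
  have k0 : 0 < (k`!%:R : R) by rewrite ltr0n fact_gt0.
  rewrite Normc.normcM; apply: ler_pM; rewrite ?normc_ge0//.
    rewrite Normc.normcM Normc.normcV normc_nat ler_pdivrMr//.
    exact: fa.
  apply: normc_pcoef => i.
  rewrite Normc.normcM Normc.normcV normc_nat ler_wpM2r ?invr_ge0//.
  have [C phiC] := tower_bounded i X_compact phi_tower.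
  exact: normc_le_supnorm phiC Xx.
have t0 n k : 0 <= a k * pcoef jet_norm k n by rewrite mulr_ge0// pcoef_ge0.
rewrite (@le_trans _ _ (\sum_(n < N) \sum_(k < N)
    fact_weight M n * (a k * pcoef jet_norm k n)))//.
  apply: ler_sum => n _; rewrite -mulr_sumr.
  rewrite (@le_trans _ _ (fact_weight M n * \sum_(k < n.+1) a k * pcoef jet_norm k n))//.
    rewrite /fact_weight mulrAC ler_wpM2r ?invr_ge0 ?(ltW (M0 _))//.
    apply: supnorm_le; last exact: bound.
    by rewrite mulr_ge0// sumr_ge0.
  rewrite ler_wpM2l ?(ltW (fact_weight_gt0 M_weight _))//.
  rewrite (big_ord_widen N (fun k => a k * pcoef jet_norm k n) (ltn_ord n)) /=.
  by rewrite big_mkcond /=; apply: ler_sum => k _; case: ifP.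
rewrite exchange_big /= le_eqVlt; apply/orP; left; apply/eqP.
apply: eq_bigr => k _; rewrite /majorant mulr_sumr.
by apply: eq_bigr => n _; rewrite mulrCA.
Qed.

Let radius : exists2 s : R, 0 < s & forall x, X x -> closed_disc (phi x) s `<=` Y.
Proof.
apply: uniform_closed_disc => // x Xx e e0.
exact: has_cderiv_continuous (phi_tower 0%N Xx) _ e0.
Qed.

Let geometric_sum N : \sum_(k < N) 2^-1 ^+ k <= 2 :> R.
Proof.
suff -> : \sum_(k < N) 2^-1 ^+ k = 2 - 2 * 2^-1 ^+ N :> R.
  by rewrite gerBl mulr_ge0// exprn_ge0.
elim: N => [|N IH]; first by rewrite big_ord0 expr0; ring.
by rewrite big_ord_recr /= IH exprS; field.
Qed.

Let sup_bound f (B : R) : infinitely_differentiable Y f ->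
  (dnorm Y M f <= B%:E)%E -> forall k z, Y z -> normc (cderivn Y k f z) <= B * M k.
Proof. by move=> fY fB k z; exact: normc_cderivn_le. Qed.

Let M_0 : M 0%N = 1.
Proof. by case: M_weight. Qed.

Lemma Dalg_comp f : Dalg Y M f -> Dalg X M (f \o phi).
Proof.
move=> [fY fo]; have [s s0 sY] := radius.
have [S fS] := dnorm_partial_sums M0 fo.
have fB : (dnorm Y M f <= S%:E)%E by exact: dnorm_le.
have e0 : 0 < s / 16 by rewrite divr_gt0.
have [C C0 CP] := majorant_decay e0.
pose B := Num.max S 0.
have B0 : 0 <= B by rewrite le_max lexx orbT.
(* With decay [s / 16], the terms of the sum are at most [B C / 2 ^ k]. *)
pose a k := B * (8 / s) ^+ k.
have a0 k : 0 <= a k by rewrite mulr_ge0// exprn_ge0// divr_ge0// ltW.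
have fa k x : X x -> normc (cderivn Y k f (phi x)) <= a k * k`!%:R.
  move=> Xx; apply: (cauchy_estimate k Y_compact (cderivn_tower fY) s0 (sY x Xx)).
  move=> z /(sY x Xx) Yz; rewrite (le_trans (sup_bound fY fB 0%N Yz))// M_0 mulr1.
  by rewrite le_max lexx.
split; first by have [] := compose_norm 0 fY fa a0.
apply: (@le_lt_trans _ _ (B * C * 2)%:E); last by rewrite ltry.
apply: dnorm_le => // N; have [_ /le_trans->//] := compose_norm N fY fa a0.
rewrite (le_trans _ (ler_wpM2l (mulr_ge0 B0 C0) (geometric_sum N)))//.
rewrite mulr_sumr ler_sum// => k _.
rewrite (le_trans (ler_wpM2l (a0 k) (CP k N)))// /a le_eqVlt; apply/orP; left.
have -> : (2^-1 : R) = (8 / s) * (s / 16) by field; rewrite gt_eqF.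
by rewrite (exprMn k (8 / s) (s / 16)); apply/eqP; ring.
Qed.

Section Compact.
Variables (u : nat -> R[i] -> R[i]) (B : R).
Hypothesis (uD : forall k, Dalg Y M (u k)).
Hypothesis (uB : forall k, (dnorm Y M (u k) <= B%:E)%E).
Variables (U : set_system nat) (UU : UltraFilter U).

Let uY n : infinitely_differentiable Y (u n).
Proof. by case: (uD n). Qed.

(** Equicontinuity near [phi @` X], which [schwarz_estimate] derives from the
    uniform bound on the [k]-th derivatives, makes the pointwise Cauchy
    property uniform on this compact set. *)
Let uniformly_cauchy k (e : R) : 0 < e -> exists2 A, U A & forall n m, A n -> A m ->
  forall x, X x -> normc (cderivn Y k (u n) (phi x) - cderivn Y k (u m) (phi x)) <= e.
Proof.
move=> e0; have [s s0 sY] := radius.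
have e3 : 0 < e / 3 by rewrite divr_gt0.
have ukB n z : Y z -> normc (cderivn Y k (u n) z) <= B * M k.
  exact: sup_bound.
have [[x0 Xx0]|X0] := pselect (X !=set0); last first.
  by exists setT => [|n m _ _ x Xx]; [exact: filterT|case: X0; exists x].
have BM0 : 0 <= B * M k := le_trans (normc_ge0 _) (ukB 0%N _ (phiY Xx0)).
pose L := 2 * (B * M k) / s.
have L0 : 0 <= L by rewrite divr_ge0 ?(ltW s0)// mulr_ge0.
have lip n x z : X x -> normc (z - phi x) <= s ->
    normc (cderivn Y k (u n) z - cderivn Y k (u n) (phi x)) <= L * normc (z - phi x).
  move=> Xx zs.
  have [_] := schwarz_estimate Y_compact (tower_shift k (cderivn_tower (@uY n)))
    s0 (sY x Xx) (fun w ws => ukB n w (sY x Xx w ws)).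
  exact.
have : \forall p \near filter_prod U U, forall x, X x ->
    normc (cderivn Y k (u p.1) (phi x) - cderivn Y k (u p.2) (phi x)) <= e.
  apply: compact_uniformly => // x Xx.
  pose rho := Num.min s (e / 3 / (L + 1)).
  have rho0 : 0 < rho by rewrite lt_min s0 divr_gt0// ltr_wpDl.
  have [r r0 rphi] := has_cderiv_continuous (phi_tower 0%N Xx) rho0.
  have [A UA AP] := ultra_cauchyC UU (fun n => ukB n _ (phiY Xx)) e3.
  exists r => //; exists (A `*` A); first by exists (A, A).
  move=> x' [n m] Xx' xr [/= An Am].
  have := rphi _ Xx' xr; rewrite /= lt_min => /andP[zs zL].
  have step i : normc (cderivn Y k (u i) (phi x') - cderivn Y k (u i) (phi x)) <= e / 3.
    rewrite (le_trans (lip i x _ Xx (ltW zs)))//.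
    rewrite (@le_trans _ _ ((L + 1) * normc (phi x' - phi x)))//.
      by rewrite ler_wpM2r ?normc_ge0// lerDl.
    by rewrite mulrC -ler_pdivlMr ?ltW// ltr_wpDl.
  have := step n; have := step m; have := ltW (AP _ _ An Am).
  set un := cderivn Y k (u n); set um := cderivn Y k (u m) => h1 h2 h3.
  rewrite (le_trans (normc_dist_triangle (un (phi x)) _ _))//.
  have := normc_dist_triangle (um (phi x)) (un (phi x)) (um (phi x')).
  by rewrite (normc_distC (um (phi x)) (um (phi x'))); lra.
move=> [[A A'] [/= UA UA'] AP]; exists (A `&` A'); first exact: filterI.
by move=> n m [An _] [_ A'm] x Xx; exact: (AP (n, m)).
Qed.

Let uniformly_cauchy_upto K (e : R) : 0 < e -> exists2 A, U A & forall n m,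
  A n -> A m -> forall k, (k < K)%N -> forall x, X x ->
  normc (cderivn Y k (u n) (phi x) - cderivn Y k (u m) (phi x)) <= e.
Proof.
move=> e0; elim: K => [|K [A UA AP]]; first by exists setT; [exact: filterT|].
have [A' UA' AP'] := uniformly_cauchy K e0.
exists (A `&` A'); first exact: filterI.
move=> n m [An A'n] [Am A'm] k; rewrite ltnS leq_eqVlt => /orP[/eqP->|kK].
  exact: AP'.
exact: AP.
Qed.

(** The terms of low order are small by uniform convergence, those of high
    order by the Cauchy estimates. *)
Lemma compositions_cauchy (e : R) : 0 < e -> exists2 A, U A & forall n m,
  A n -> A m -> (dnorm X M ((u n \o phi) - (u m \o phi))%R < e%:E)%E.
Proof.
move=> e0; have [s s0 sY] := radius.
have s16 : 0 < s / 16 by rewrite divr_gt0.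
have [C C0 CP] := majorant_decay s16.
pose B' := Num.max (2 * B) 0.
have B'0 : 0 <= B' by rewrite le_max lexx orbT.
pose c k := B' * (8 / s) ^+ k.
have c0 k : 0 <= c k by rewrite mulr_ge0// exprn_ge0// divr_ge0// ltW.
pose v k := B' * C * 2^-1 ^+ k.
have v0 k : 0 <= v k by rewrite mulr_ge0 ?exprn_ge0// mulr_ge0.
have vS N : \sum_(k < N) v k <= B' * C * 2.
  by rewrite -mulr_sumr ler_wpM2l ?geometric_sum// mulr_ge0.
have cv k N : c k * majorant k N <= v k.
  rewrite (le_trans (ler_wpM2l (c0 k) (CP k N)))// /v /c le_eqVlt; apply/orP; left.
  have -> : (2^-1 : R) = (8 / s) * (s / 16) by field; rewrite gt_eqF.
  by rewrite (exprMn k (8 / s) (s / 16)); apply/eqP; ring.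
have e2 : 0 < e / 2 by rewrite divr_gt0.
have [K tailK] := small_tail v0 vS e2.
pose S := \sum_(k < K) C * (s / 16) ^+ k.
have S0 : 0 <= S.
  by rewrite sumr_ge0// => k _; rewrite mulr_ge0// exprn_ge0// ltW.
pose h := e / (4 * (S + 1)).
have S1 : 0 < S + 1 by rewrite ltr_wpDl.
have h0 : 0 < h by rewrite divr_gt0// mulr_gt0.
have hS : h * S <= e / 4.
  have -> : e / 4 = h * (S + 1) by rewrite /h; field; rewrite gt_eqF.
  by apply: ler_wpM2l; [exact: ltW | rewrite lerDl].
have [A UA AP] := uniformly_cauchy_upto K h0.
exists A => // n m An Am.
pose G k := cderivn Y k (u n) \- cderivn Y k (u m).
have G_tower : derivative_tower Y G.
  by move=> k z Yz; apply: has_cderivB; exact: cderivn_tower.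
have [gY gE] := tower_cderivn (perfect_limit_point Y_perfect) G_tower
  (fun z _ => erefl : (u n - u m)%R z = G 0%N z).
pose a k := if (k < K)%N then h else c k.
have a0 k : 0 <= a k by rewrite /a; case: ifP => // _; exact: ltW.
have ga k x : X x -> normc (cderivn Y k (u n - u m)%R (phi x)) <= a k * k`!%:R.
  move=> Xx; rewrite gE; last exact: phiY.
  rewrite /a; case: ifP => kK.
    rewrite (le_trans (AP n m An Am k kK x Xx))// ler_peMr ?(ltW h0)//.
    by rewrite ler1n fact_gt0.
  apply: (cauchy_estimate k Y_compact G_tower s0 (sY x Xx)) => z zs.
  have Yz := sY x Xx z zs.
  have := sup_bound (@uY n) (uB n) 0%N Yz; have := sup_bound (@uY m) (uB m) 0%N Yz.
  rewrite M_0 mulr1 /= => um un.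
  rewrite (le_trans (normc_sub _ _))// (@le_trans _ _ (2 * B))//; first by lra.
  by rewrite le_max lexx.
apply: (@le_lt_trans _ _ (e / 4 + e / 2)%:E); last by rewrite lte_fin; lra.
apply: dnorm_le => // N.
have [_ /le_trans->//] := compose_norm N gY ga a0.
rewrite (bigID (fun k : 'I_N => (k < K)%N)) /= lerD//.
  rewrite (le_trans _ hS)// /S mulr_sumr.
  rewrite (le_trans _ (@sum_truncate_le _ (fun k => h * (C * (s / 16) ^+ k)) N K _))//.
    by apply: ler_sum => k kK; rewrite /a kK ler_wpM2l ?CP ?(ltW h0).
  by move=> k; rewrite mulr_ge0 ?(ltW h0)// mulr_ge0// exprn_ge0// ltW.
rewrite (le_trans _ (tailK N))//.
under eq_bigl do rewrite -leqNgt.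
by apply: ler_sum => k kK; rewrite /a ltnNge kK /= cv.
Qed.

End Compact.

End Composition.

Theorem theorem3 (R : realType) (X Y : set R[i]) (M : nat -> R)
    (phi : R[i] -> R[i])
    (X_compact : compact X) (X_perfect : perfect_set X)
    (Y_compact : compact Y) (Y_perfect : perfect_set Y)
    (M_weight : weight_sequence M)
    (X_good : good_algebra X M) (Y_good : good_algebra Y M)
    (phi_D : Dalg X M phi) (phi_int : phi @` X `<=` Y°) :
  induces_homomorphism X Y M phi /\
  compact_linear_operator Y X M (fun f => f \o phi).
Proof.
have [X_complete M_na _] := X_good.
have comp_D f : Dalg Y M f -> Dalg X M (f \o phi) by exact: Dalg_comp.
have XY : phi @` X `<=` Y by move=> y /phi_int; exact: nbhs_singleton.
split; first by split.
split=> // [f g _ _ fg x Xx|u uD [B uB]].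
  by apply: fg; apply: XY; exists x.
have [U [UU ooU]] := ultraFilterLemma (eventually_filter).
have [s s_incr s_cauchy] := cauchy_subsequence UU ooU
  (fun e => compositions_cauchy X_compact X_perfect Y_compact Y_perfect M_weight
     M_na phi_D phi_int uD uB UU (e := e)).
exists s => //; apply: X_complete => // k; exact: comp_D.
Qed.
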